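(* Let $M$ be a loopless matroid of rank $k$ on a ground set of size $n$. Then, coefficient-wise, $\underline{H}_M(x)\preceq\underline{H}_{U_{k,n}}(x)$ and $H_M(x)\preceq H_{U_{k,n}}(x)$.
   Context: For polynomials $A,B$ with real coefficients, $A\preceq B$ means $B-A$ has nonnegative coefficients. $U_{k,n}$ is the uniform matroid of rank $k$ on $n$ elements (bases: all $k$-subsets). For a loopless matroid $M$ on $E$ with lattice of flats $\mathcal{L}(M)$: $\underline{\mathrm{CH}}(M)=\mathbb{Q}[x_F: F\in\mathcal{L}(M)\setminus\{\varnothing,E\}]/(I+J)$, $I$ generated by $x_{F_1}x_{F_2}$ for incomparable $F_1,F_2$, $J$ by $\sum_{F\ni i}x_F-\sum_{F\ni j}x_F$ for $i,j\in E$; $\mathrm{CH}(M)=\mathbb{Q}[x_F,y_i: F\in\mathcal{L}(M)\setminus\{E\},\, i\in E]/(I'+J')$, $I'$ generated by $y_i-\sum_{F\not\ni i}x_F$, $J'$ by $x_{F_1}x_{F_2}$ for incomparable $F_1,F_2$ and $y_ix_F$ for $i\notin F$. Variables of degree $1$; $\underline{H}_M$ and $H_M$ are the Hilbert series $\sum_j\dim_{\mathbb{Q}}(\cdot)^jx^j$. *)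

(* Defs.v *)
From HB Require Import structures.
From mathcomp Require Import all_boot all_order all_algebra.
From mathcomp Require Import mpoly.
From Stdlib Require Import ClassicalDescription.
Set Implicit Arguments.
Unset Strict Implicit.
Unset Printing Implicit Defensive.
Import Order.TTheory GRing.Theory Num.Theory.
Local Open Scope ring_scope.

Definition is_matroid (n : nat) (Ind : {set {set 'I_n}}) : Prop :=
  [/\ set0 \in Ind,
      (forall A B : {set 'I_n}, B \in Ind -> A \subset B -> A \in Ind) &
      (forall A B : {set 'I_n}, A \in Ind -> B \in Ind -> (#|A| < #|B|)%N ->
          exists2 x, x \in B :\: A & x |: A \in Ind)].

Definition mrank (n : nat) (Ind : {set {set 'I_n}}) (A : {set 'I_n}) : nat :=
  (\max_(B in Ind | B \subset A) #|B|)%N.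

Definition matroid_rank (n : nat) (Ind : {set {set 'I_n}}) : nat :=
  mrank Ind [set: 'I_n].

Definition loopless (n : nat) (Ind : {set {set 'I_n}}) : Prop :=
  forall x : 'I_n, [set x] \in Ind.

Definition is_flat (n : nat) (Ind : {set {set 'I_n}}) (F : {set 'I_n}) : bool :=
  [forall x, (x \notin F) ==> (mrank Ind F < mrank Ind (x |: F))%N].

Definition flats (n : nat) (Ind : {set {set 'I_n}}) : {set {set 'I_n}} :=
  [set F | is_flat Ind F].

Definition uniform (k n : nat) : {set {set 'I_n}} :=
  [set S : {set 'I_n} | (#|S| <= k)%N].

Definition in_ideal (N : nat) (gs : seq {mpoly rat[N]}) (p : {mpoly rat[N]}) : Prop :=
  exists cs : seq {mpoly rat[N]}, p = \sum_(i < size gs) cs`_i * gs`_i.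

Definition quot_indep (N : nat) (gs : seq {mpoly rat[N]}) (j : nat)
    (ps : seq {mpoly rat[N]}) : Prop :=
  all (fun p => p \is j.-homog) ps /\
  (forall c : 'I_(size ps) -> rat,
      in_ideal gs (\sum_(i < size ps) c i *: ps`_i) -> forall i, c i = 0).

(* dim_Q of the degree-j part of Q[x_1..x_N]/(gs): the maximal size of a
   family of degree-j elements independent in the quotient.  The search is
   bounded by (j+1)^N, which bounds the number of degree-j monomials and
   hence the dimension. *)
Definition hilb_coeff (N : nat) (gs : seq {mpoly rat[N]}) (j : nat) : nat :=
  (\max_(d < ((j.+1) ^ N).+1 |
          if excluded_middle_informative
               (exists ps, size ps = val d /\ quot_indep gs j ps)
          then true else false) val d)%N.

Section ChowRings.
Variables (n : nat) (Ind : {set {set 'I_n}}).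

(* proper nonempty flats, enumerated; variable x_F is 'X_i for F = pflat i *)
Definition pflats : seq {set 'I_n} :=
  enum [set F in flats Ind | (F != set0) && (F != [set: 'I_n])].

Definition incomparable (F G : {set 'I_n}) : bool :=
  ~~ (F \subset G) && ~~ (G \subset F).

Definition redchow_gens : seq {mpoly rat[size pflats]} :=
  [seq 'X_(ij.1) * 'X_(ij.2)
     | ij <- enum [set ij : 'I_(size pflats) * 'I_(size pflats) |
                   incomparable (nth set0 pflats ij.1) (nth set0 pflats ij.2)]] ++
  [seq (\sum_(i < size pflats | a \in nth set0 pflats i) 'X_i) -
       (\sum_(i < size pflats | b \in nth set0 pflats i) 'X_i)
     | a <- enum 'I_n, b <- enum 'I_n].

Definition redchow_hilb (j : nat) : nat := hilb_coeff redchow_gens j.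

(* The Chow ring CH(M): variables x_F (F flat, F <> E), then y_i (i in E) *)
Definition nflats : seq {set 'I_n} :=
  enum [set F in flats Ind | F != [set: 'I_n]].

Definition chow_gens : seq {mpoly rat[size nflats + n]} :=
  [seq 'X_(rshift (size nflats) a) -
       (\sum_(i < size nflats | a \notin nth set0 nflats i) 'X_(lshift n i))
     | a <- enum 'I_n] ++
  [seq 'X_(lshift n ij.1) * 'X_(lshift n ij.2)
     | ij <- enum [set ij : 'I_(size nflats) * 'I_(size nflats) |
                   incomparable (nth set0 nflats ij.1) (nth set0 nflats ij.2)]] ++
  [seq 'X_(rshift (size nflats) ai.1) * 'X_(lshift n ai.2)
     | ai <- enum [set ai : 'I_n * 'I_(size nflats) |
                   ai.1 \notin nth set0 nflats ai.2]].

Definition chow_hilb (j : nat) : nat := hilb_coeff chow_gens j.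

End ChowRings.

(* Main.v *)
(* Both Chow rings have a basis of Feichtner-Yuzvinsky monomials: products of powers of x_F along a
   chain of nonempty flats, where the exponent of x_F is smaller than the jump of the rank from the
   previous flat of the chain (here x_E stands for minus the sum of the other variables occurring in
   the linear relations, and the first jump is one larger in the augmented ring). Greedily choosing
   nested bases along a chain F_1 < F_2 < ... of flats of M gives a chain of independent sets
   B_1 < B_2 < ... from which F_i is recovered as the closure of B_i. Since B_i is a flat of U_{k,n}
   of the same rank as F_i, this embeds the basis for M into the basis for U_{k,n}.

   Monomials satisfying the exponent bounds span, because x_C h_G^(r G - r C) = 0 for flats C < G,
   where h_G is the sum of the x_K with K above G, and solving for x_C x_G^(r G - r C) leaves only
   monomials in larger flats. They are independent because the products with the dual monomials,
   whose exponents are complementary, form a triangular matrix with entries +-x_E^top on the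
   diagonal. Finally x_E^top is nonzero because the functional sending a monomial in the h_G to 1 or
   0 according to the dragon Hall-Rado condition kills the ideal: this is an instance of
   submodularity of the rank. The parameter e is 1 for the reduced and 0 for the augmented ring. *)

(* The comparison uses spanning for $M$ and independence for $U_{k,n}$; both are proved for every
   loopless matroid. The two rings are treated at once after eliminating $x_\varnothing$ and the
   $y_i$ in favour of $x_E$: the generators are then the $x_F$ for nonempty flats, and three
   relations are used, namely $x_Fx_G=0$ for incomparable flats, $h_ax_F=0$ for $a\notin F$, and
   $h_a^{2-e}=0$. In the reduced ring $h_a=0$; in the augmented ring $h_a=-y_a$ and $y_a^2=0$. The
   shift in [shifted_rank] has its origin in this exponent. The obstacle is that relations alone
   never exclude a collapse of the quotient, so a functional has to be defined on a free polynomial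
   ring and shown to kill the ideal. Its variables are the $h_T$ because its values on their
   monomials are 0 or 1, while those on monomials in the $x_F$ carry signs; the $x_F$ are recovered
   by inversion over the flats. Incomparability becomes $(h_F-h_J)(h_G-h_J)=0$, with $J$ the join,
   which is an uncrossing statement about tight flats. *)
Require Import Defs.
From HB Require Import structures.
From mathcomp Require Import all_boot all_order all_algebra.
From mathcomp Require Import mpoly.
From mathcomp Require Import generic_quotient ring_quotient zify ring.
From Stdlib Require Import ClassicalDescription.
Set Implicit Arguments.
Unset Strict Implicit.
Unset Printing Implicit Defensive.
Import GRing.Theory.

(** * Rank, closure and flats *)

(* [lia] compares atoms syntactically, but the implicit [finType] structures of equal sets may differ. *)
Ltac rlia := repeat (let z := fresh "z" in move: (mrank _ _) => z); lia.

Section MatroidRank.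
Variables (n : nat) (Ind : {set {set 'I_n}}).
Hypothesis HM : is_matroid Ind.
Local Notation r := (mrank Ind).
Local Notation flat := (is_flat Ind).

Lemma indep_sub (A B : {set 'I_n}) : B \in Ind -> A \subset B -> A \in Ind.
Proof. by case: HM => _ h _; apply: h. Qed.

Lemma mrank_ge (A B : {set 'I_n}) : B \in Ind -> B \subset A -> #|B| <= r A.
Proof.
move=> BI BA; rewrite /mrank.
by apply: (@leq_bigmax_cond _ (fun B => (B \in Ind) && (B \subset A)) (fun B : {set 'I_n} => #|B|)); rewrite BI.
Qed.

Lemma mrank_basis (A I : {set 'I_n}) : I \in Ind -> I \subset A ->
  exists J, [/\ J \in Ind, I \subset J, J \subset A & #|J| = r A].
Proof.
move=> II IA.
have P0 : [&& I \in Ind, I \subset I & I \subset A] by rewrite II subxx IA.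
case: (@arg_maxnP _ I (fun J : {set 'I_n} => [&& J \in Ind, I \subset J & J \subset A])
  (fun J : {set 'I_n} => #|J|) P0).
move=> J /and3P[JI IJ JA] Jmax; exists J; split=> //.
apply/eqP; rewrite eqn_leq mrank_ge //= leqNgt; apply/negP => lt.
have [|B /andP[BI BA] eB] := @eq_bigmax_cond _ (fun B => (B \in Ind) && (B \subset A))
  (fun B : {set 'I_n} => #|B|).
  by apply/card_gt0P; exists I; rewrite unfold_in /= II.
rewrite /mrank eB in lt.
case: HM => _ _ /(_ _ _ JI BI lt) [x /setDP[xB xJ] xJI].
have := Jmax (x |: J); rewrite xJI (subset_trans IJ (subsetUr _ _)) subUset sub1set.
by rewrite (subsetP BA _ xB) JA cardsU1 xJ => /(_ isT); rewrite /= add1n ltnn.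
Qed.

Lemma indep0 : set0 \in Ind.
Proof. by case: HM. Qed.

Lemma mrank_le_card (A : {set 'I_n}) : r A <= #|A|.
Proof.
have [J [_ _ JA <-]] := mrank_basis indep0 (sub0set A).
exact: subset_leq_card.
Qed.

Lemma mrankS (A B : {set 'I_n}) : A \subset B -> r A <= r B.
Proof.
move=> AB; have [J [JI _ JA <-]] := mrank_basis indep0 (sub0set A).
by apply: mrank_ge => //; apply: subset_trans AB.
Qed.

Lemma mrank_indep (A : {set 'I_n}) : A \in Ind -> r A = #|A|.
Proof. by move=> AI; apply/eqP; rewrite eqn_leq mrank_le_card mrank_ge. Qed.

(** A basis [I] of the intersection extends to a basis [J] of the union; inclusion-exclusion for
    [J :&: A] and [J :&: B] finds [I] inside their common part. *)
Lemma mrank_submod (A B : {set 'I_n}) : r (A :|: B) + r (A :&: B) <= r A + r B.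
Proof.
have [I [II _ IA <-]] := mrank_basis indep0 (sub0set (A :&: B)).
have IU : I \subset A :|: B.
  by apply: subset_trans IA _; rewrite subIset // subsetUl.
have [J [JI IJ JA <-]] := mrank_basis II IU.
apply: (@leq_trans (#|J :&: A| + #|J :&: B|)); last first.
  by rewrite leq_add // mrank_ge ?subsetIr //; apply: indep_sub JI _; rewrite subsetIl.
rewrite -[leqRHS]cardsUI -setIUr (setIidPl JA) leq_add2l subset_leq_card //.
by rewrite -setIIr subsetI IJ.
Qed.

Lemma mrank0 : r set0 = 0.
Proof. by apply/eqP; rewrite -leqn0 -(cards0 'I_n) mrank_le_card. Qed.

Lemma mrankU1 (x : 'I_n) (A : {set 'I_n}) : r (x |: A) <= (r A).+1.
Proof.
have h1 := mrank_submod [set x] A; have h2 := mrank_le_card [set x].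
by rewrite cards1 in h2; move: h1 h2; rlia.
Qed.

Definition mclosure (A : {set 'I_n}) : {set 'I_n} := [set x | r (x |: A) == r A].
Local Notation cl := mclosure.

Lemma sub_cl (A : {set 'I_n}) : A \subset cl A.
Proof.
by apply/subsetP => x xA; rewrite inE (setUidPr _) // sub1set.
Qed.

Lemma mrank_cl (A : {set 'I_n}) : r (cl A) = r A.
Proof.
apply/eqP; rewrite eqn_leq [X in _ && X]mrankS ?sub_cl // andbT leqNgt; apply/negP => lt.
have [J [JI _ JA eJ]] := mrank_basis indep0 (sub0set A).
have [K [KI JK KA eK]] := mrank_basis JI (subset_trans JA (sub_cl A)).
have /properP[_ [x xK xJ]] : J \proper K by rewrite properEcard JK eJ eK.
have := subsetP KA _ xK; rewrite inE => /eqP e.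
have : #|x |: J| <= r (x |: A).
  rewrite mrank_ge ?setUS //; apply: indep_sub KI _.
  by rewrite subUset sub1set xK.
by rewrite cardsU1 xJ e -eJ add1n ltnn.
Qed.

Lemma flat_cl (A : {set 'I_n}) : flat (cl A).
Proof.
apply/forallP => x; apply/implyP => xA; rewrite mrank_cl.
apply: (@leq_trans (r (x |: A))); last by rewrite mrankS // setUS // sub_cl.
by rewrite ltn_neqAle eq_sym mrankS ?subsetUr // andbT; rewrite inE in xA.
Qed.

Lemma flatP (F : {set 'I_n}) (x : 'I_n) : flat F -> x \notin F -> r F < r (x |: F).
Proof. by move=> /forallP/(_ x)/implyP. Qed.

Lemma cl_min (A F : {set 'I_n}) : flat F -> A \subset F -> cl A \subset F.
Proof.
move=> fF AF; apply/subsetP => x; rewrite inE => /eqP e; apply/negPn/negP => xF.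
have := flatP fF xF; have := mrank_submod (x |: A) F.
rewrite -setUA (setUidPr AF) e.
have : r A <= r ((x |: A) :&: F) by rewrite mrankS // subsetI subsetUr.
by rlia.
Qed.

Lemma sub_clE (A F : {set 'I_n}) : flat F -> (cl A \subset F) = (A \subset F).
Proof.
by move=> fF; apply/idP/idP; [apply: subset_trans (sub_cl A)|apply: cl_min].
Qed.

Lemma mrank_proper (F G : {set 'I_n}) : flat F -> F \proper G -> r F < r G.
Proof.
move=> fF /properP[FG [x xG xF]]; apply: leq_trans (flatP fF xF) _.
by rewrite mrankS // subUset sub1set xG.
Qed.

Lemma flatI (F G : {set 'I_n}) : flat F -> flat G -> flat (F :&: G).
Proof.
suff h (A B : {set 'I_n}) x : flat A -> x \notin A -> r (A :&: B) < r (x |: (A :&: B)).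
  move=> fF fG; apply/forallP => x; apply/implyP; rewrite inE negb_and => /orP[]; first exact: h.
  by rewrite setIC; apply: h.
move=> fA xA; have := mrank_submod (x |: (A :&: B)) A.
rewrite -setUA (setUidPr (subsetIl _ _)).
have : r (A :&: B) <= r ((x |: (A :&: B)) :&: A) by rewrite mrankS // subsetI subsetUr subsetIl.
have := flatP fA xA; rlia.
Qed.

Lemma flatT : flat [set: 'I_n].
Proof. by apply/forallP => x; rewrite inE. Qed.

Lemma mrank_flat_lt (F : {set 'I_n}) : flat F -> F != setT -> r F < matroid_rank Ind.
Proof. by move=> fF FT; apply: mrank_proper; rewrite // properT. Qed.

(** The induction removes the largest member [F]: the set [B] found for the others is cut down to
    [F] and extended to a basis of [F]. The extension keeps [B :&: G] for smaller [G], and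
    independence stops it from exceeding [r G] there. *)
Lemma nested_bases (P : {set {set 'I_n}}) :
  {in P &, forall F G : {set 'I_n}, (F \subset G) || (G \subset F)} ->
  exists2 B, B \in Ind & forall F, F \in P -> #|B :&: F| = r F.
Proof.
have [m] := ubnP #|P|; elim: m P => // m IH P Pm cP.
have [->|[F0 F0P]] := set_0Vmem P.
  by exists set0 => [|F]; rewrite ?indep0 ?inE.
case: (@arg_maxnP _ F0 (mem P) (fun J : {set 'I_n} => #|J|) F0P) => F FP Fmax.
have {}FP : F \in P by [].
have sF G : G \in P -> G \subset F.
  move=> GP; have /orP[//|FG] := cP _ _ GP FP.
  have /eqP -> // : F == G by rewrite eqEcard FG; apply: Fmax.
have [|G G' /setD1P[_ GP] /setD1P[_ GP']|B BI eB] := IH (P :\ F).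
- by move: Pm; rewrite (cardsD1 F P) FP; lia.
- exact: cP.
have [|J [JI BJ JF eJ]] := @mrank_basis F (B :&: F) _ (subsetIr _ _).
  by apply: indep_sub BI _; rewrite subsetIl.
exists J => // G GP; have [->|GF] := eqVneq G F; first by rewrite (setIidPl JF).
apply/eqP; rewrite eqn_leq; apply/andP; split.
  by rewrite mrank_ge ?subsetIr //; apply: indep_sub JI _; rewrite subsetIl.
rewrite -(eB G) ?inE ?GF // subset_leq_card // subsetI subsetIr andbT.
by apply: subset_trans BJ; rewrite setIS // sF.
Qed.

Section Loopless.
Hypothesis HL : loopless Ind.

Lemma mrank1 x : r [set x] = 1.
Proof. by rewrite mrank_indep ?cards1. Qed.

Lemma flat0 : flat set0.
Proof. by apply/forallP => x; rewrite setU0 mrank0 mrank1 // implybT. Qed.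

Lemma mrank_gt0 (A : {set 'I_n}) : (0 < r A) = (A != set0).
Proof.
have [->|[x xA]] := set_0Vmem A; first by rewrite mrank0 eqxx.
have -> : A != set0 by apply/set0Pn; exists x.
by rewrite -(mrank1 x) mrankS // sub1set.
Qed.

End Loopless.
End MatroidRank.

(** * Monomials and integral spans *)

(** Integer coefficients suffice because every straightening relation has them, so the target can be
    any commutative ring without a scalar action. *)
Inductive zspan (A : zmodType) (S : A -> Prop) : A -> Prop :=
| zspan0 : zspan S 0%R
| zspanD a b : zspan S a -> S b -> zspan S (a + b)%R
| zspanB a b : zspan S a -> S b -> zspan S (a - b)%R.

Section Zspan.
Local Open Scope ring_scope.

Lemma zspan_gen (A : zmodType) (S : A -> Prop) a : S a -> zspan S a.
Proof. by move=> Sa; rewrite -[a]add0r; apply: zspanD => //; apply: zspan0. Qed.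

Lemma zspan_add (A : zmodType) (S : A -> Prop) a b : zspan S a -> zspan S b -> zspan S (a + b).
Proof.
move=> Sa; elim=> [|c d _ IH Sd|c d _ IH Sd]; rewrite ?addr0 // addrA.
  exact: zspanD.
exact: zspanB.
Qed.

Lemma zspan_opp (A : zmodType) (S : A -> Prop) a : zspan S a -> zspan S (- a).
Proof.
elim=> [|c d _ IH Sd|c d _ IH Sd]; rewrite ?oppr0 ?opprB 1?opprD //.
- exact: zspan0.
- exact: zspanB.
- by rewrite addrC; apply: zspanD.
Qed.

Lemma zspan_sum (A : zmodType) (S : A -> Prop) I (s : seq I) (P : pred I) (f : I -> A) :
  (forall i, P i -> zspan S (f i)) -> zspan S (\sum_(i <- s | P i) f i).
Proof. by move=> h; apply: big_ind => //; [apply: zspan0|apply: zspan_add]. Qed.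

Lemma zspan_bind (A B : zmodType) (f : {additive A -> B}) (S : A -> Prop) (T : B -> Prop) a :
  (forall b, S b -> zspan T (f b)) -> zspan S a -> zspan T (f a).
Proof.
move=> h; elim=> [|c d _ IH Sd|c d _ IH Sd]; rewrite ?raddf0 ?raddfD ?raddfN.
- exact: zspan0.
- by apply: zspan_add => //; apply: h.
- by apply: zspan_add => //; apply: zspan_opp; apply: h.
Qed.

Lemma zspan_mul (A : pzRingType) (S T U : A -> Prop) a b :
  (forall c d, S c -> T d -> U (c * d)) -> zspan S a -> zspan T b -> zspan U (a * b).
Proof.
move=> h Sa Tb; apply: (@zspan_bind _ _ (a \*o idfun) T) => // d Td.
apply: (@zspan_bind _ _ (d \o* idfun) S) => // c Sc /=.
by apply: zspan_gen; apply: h.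
Qed.

Lemma zspan_empty (A : zmodType) (S : A -> Prop) a : (forall b, S b -> b = 0) -> zspan S a -> a = 0.
Proof.
move=> h; elim=> [|c d _ -> /h->|c d _ -> /h->] //; by rewrite ?addr0 ?subr0.
Qed.
End Zspan.

Section Monomials.
Variables (T : finType) (A : comNzRingType) (x : {set T} -> A).
Implicit Types m : {set T} -> nat.

Definition xmon m : A := (\prod_F x F ^+ m F)%R.
Local Notation mon := xmon.
Definition deg m := \sum_F m F.
(** Termination measure of the straightening: for fixed degree it is bounded by [wt_le], and it
    grows when a factor is replaced by one of a larger flat. *)
Definition wt m := \sum_F m F * #|F|.
Definition dlt (F K : {set T}) : nat := (K == F).

Lemma mon_ext m1 m2 : m1 =1 m2 -> mon m1 = mon m2.
Proof. by move=> h; apply: eq_bigr => F _; rewrite h. Qed.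
Lemma deg_ext m1 m2 : m1 =1 m2 -> deg m1 = deg m2.
Proof. by move=> h; apply: eq_bigr => F _; rewrite h. Qed.
Lemma monD m1 m2 : mon (fun K => m1 K + m2 K) = (mon m1 * mon m2)%R.
Proof. by rewrite -big_split; apply: eq_bigr => F _; rewrite exprD. Qed.
Lemma degD m1 m2 : deg (fun K => m1 K + m2 K) = deg m1 + deg m2.
Proof. exact: big_split. Qed.
Lemma wtD m1 m2 : wt (fun K => m1 K + m2 K) = wt m1 + wt m2.
Proof. by rewrite -big_split; apply: eq_bigr => F _; rewrite mulnDl. Qed.
Lemma mon_dlt F c : mon (fun K => dlt F K * c) = (x F ^+ c)%R.
Proof.
rewrite /xmon (bigD1 F) //= big1 ?mulr1 /dlt ?eqxx ?mul1n // => K /negPf ->.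
by rewrite mul0n expr0.
Qed.
Lemma deg_dlt F c : deg (fun K => dlt F K * c) = c.
Proof.
rewrite /deg (bigD1 F) //= big1 ?addn0 /dlt ?eqxx ?mul1n // => K /negPf ->.
by rewrite mul0n.
Qed.
Lemma wt_dlt F c : wt (fun K => dlt F K * c) = c * #|F|.
Proof.
rewrite /wt (bigD1 F) //= big1 ?addn0 /dlt ?eqxx ?mul1n // => K /negPf ->.
by rewrite !mul0n.
Qed.

Lemma wt_le m : wt m <= deg m * #|T|.
Proof. by rewrite /wt /deg big_distrl /= leq_sum // => F _; rewrite leq_mul // max_card. Qed.

(* [m] with [d] removed at [G] *)
Definition drp m G d K := m K - dlt G K * d.

Lemma drpK m G d : d <= m G -> m =1 (fun K => drp m G d K + dlt G K * d).
Proof.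
by move=> dm K; rewrite /drp subnK // /dlt; case: eqP => [->|_]; rewrite ?mul1n ?mul0n.
Qed.

Lemma mon_drp m G d : d <= m G -> mon m = (mon (drp m G d) * x G ^+ d)%R.
Proof. by move=> dm; rewrite (mon_ext (drpK dm)) monD mon_dlt. Qed.

Lemma mon_eq0 m F G : m F != 0 -> m G != 0 -> F != G -> (x F * x G)%R = 0%R -> mon m = 0%R.
Proof.
move=> mF mG FG xFG.
rewrite (@mon_drp m F 1) ?lt0n // (@mon_drp _ G 1) ?lt0n ?expr1.
  by rewrite -mulrA [(x G * _)%R]mulrC xFG mulr0.
by rewrite /drp /dlt [G == F]eq_sym (negPf FG) mul0n subn0.
Qed.

(** The weight is bounded only from below, since a sum over all flats above [G] mixes sizes, all of
    them at least [#|G|]. *)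
Definition monset (Q : pred {set T}) (j s : nat) (a : A) :=
  exists m, [/\ forall F, m F != 0 -> Q F, deg m = j, s <= wt m & a = mon m].

Lemma monset_mul Q i j s t a b : monset Q i s a -> monset Q j t b ->
  monset Q (i + j) (s + t) (a * b)%R.
Proof.
move=> [m [mQ mi ms ->]] [m' [mQ' mi' ms' ->]]; exists (fun K => m K + m' K).
split; rewrite ?degD ?wtD ?monD ?mi ?mi' ?leq_add // => F.
by rewrite addn_eq0 negb_and => /orP[/mQ|/mQ'].
Qed.

Lemma monset_dlt (Q : pred {set T}) F c s : Q F -> s <= c * #|F| -> monset Q c s (x F ^+ c)%R.
Proof.
move=> QF sc; exists (fun K => dlt F K * c); rewrite mon_dlt deg_dlt wt_dlt; split=> // K.
by rewrite /dlt; case: (eqVneq K F) => [->|].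
Qed.

Lemma zspan_monset_exp Q j s a c : zspan (monset Q j s) a ->
  zspan (monset Q (c * j) (c * s)) (a ^+ c)%R.
Proof.
move=> h; elim: c => [|c IH].
  rewrite expr0 !mul0n; apply: zspan_gen; exists (fun=> 0); split=> //; rewrite /deg /xmon ?big1 //.
rewrite exprS !mulSn; apply: zspan_mul h IH => b d; exact: monset_mul.
Qed.
End Monomials.

(** * Chains of flats *)

Section Gaps.
Variables (n : nat) (Ind : {set {set 'I_n}}) (e : nat).
Hypotheses (HM : is_matroid Ind) (HL : loopless Ind).
Local Notation r := (mrank Ind).
Local Notation flat := (is_flat Ind).
Local Notation k := (matroid_rank Ind).
Implicit Types (F G K C : {set 'I_n}) (S : {set {set 'I_n}}).

Definition chain S := {in S &, forall F G : {set 'I_n}, (F \subset G) || (G \subset F)}.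
Definition nonempty_flat F := flat F && (F != set0).
Definition shifted_rank F := r F + (1 - e).
Local Notation nzflat := nonempty_flat.
Local Notation rho := shifted_rank.

(** An empty maximum is 0, so the lowest member of [S] has gap [rho K]; this is where the augmented
    ring gains one in the first jump. *)
Definition rank_gap S K := rho K - \max_(C in S | C \proper K) rho C.
Local Notation gap := rank_gap.

Lemma chain_sub S S' : S \subset S' -> chain S' -> chain S.
Proof. by move=> /subsetP sS cS F G FS GS; apply: cS; apply: sS. Qed.

Lemma chain_proper S F G : chain S -> F \in S -> G \in S -> ~~ (F \subset G) -> G \proper F.
Proof. by move=> cS FS GS FG; rewrite properE FG andbT; have := cS _ _ FS GS; rewrite (negPf FG). Qed.

Lemma rhoS F G : F \subset G -> rho F <= rho G.
Proof. by move=> FG; rewrite leq_add2r mrankS. Qed.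

Lemma rho_proper F G : flat F -> F \proper G -> rho F < rho G.
Proof. by move=> fF FG; rewrite ltn_add2r mrank_proper. Qed.

Lemma rho_gt0 F : F != set0 -> 0 < rho F.
Proof. by move=> F0; rewrite ltn_addr // mrank_gt0. Qed.

Lemma lt_gap S K c : c < rho K -> (forall C, C \in S -> C \proper K -> c + rho C < rho K) ->
  c < gap S K.
Proof.
move=> cK h; rewrite /rank_gap ltn_subRL.
have : \max_(C in S | C \proper K) rho C <= rho K - c.+1.
  by apply/bigmax_leqP => C /andP[CS CK]; have := h _ CS CK; lia.
lia.
Qed.

Lemma gap_lt S K C : C \in S -> C \proper K -> gap S K + rho C <= rho K.
Proof.
move=> CS CK.
have h : rho C <= \max_(C in S | C \proper K) rho C.
  by apply: (@leq_bigmax_cond _ (fun C => (C \in S) && (C \proper K)) rho); rewrite CS.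
have : \max_(C in S | C \proper K) rho C <= rho K.
  by apply/bigmax_leqP => D /andP[_ DK]; apply: rhoS; apply: proper_sub.
by rewrite /rank_gap; lia.
Qed.

Lemma gap_rho S K : gap S K <= rho K.
Proof. exact: leq_subr. Qed.

Lemma gap_gt0 S K : {in S, forall F, flat F} -> K != set0 -> 0 < gap S K.
Proof.
move=> fS K0; apply: lt_gap; first exact: rho_gt0.
by move=> C CS CK; apply: rho_proper; rewrite ?fS.
Qed.

Lemma gap_min S K : {in S, forall C : {set 'I_n}, ~~ (C \proper K)} -> gap S K = rho K.
Proof.
move=> h; rewrite /rank_gap big_pred0 ?subn0 // => C.
by apply/andP => -[/h/negPf->].
Qed.

Lemma gap_next S K C : C \in S -> C \proper K ->
  {in S, forall D : {set 'I_n}, D \proper K -> D \subset C} -> gap S K + rho C = rho K.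
Proof.
move=> CS CK h; have : \max_(C in S | C \proper K) rho C = rho C.
  apply/eqP; rewrite eqn_leq (@leq_bigmax_cond _ (fun C => (C \in S) && (C \proper K)) rho) ?CS // andbT.
  by apply/bigmax_leqP => D /andP[DS DK]; rewrite rhoS // h.
rewrite /rank_gap => ->; rewrite subnK //; exact/rhoS/proper_sub.
Qed.

Lemma chain_pred S K : chain S -> (exists2 C, C \in S & C \proper K) ->
  exists C, [/\ C \in S, C \proper K & {in S, forall D : {set 'I_n}, D \proper K -> D \subset C}].
Proof.
move=> cS [C0 C0S C0K].
have P0 : (C0 \in S) && (C0 \proper K) by rewrite C0S.
case: (@arg_maxnP _ C0 (fun C => (C \in S) && (C \proper K)) (fun C : {set 'I_n} => #|C|) P0).
move=> C /andP[CS CK] Cmax; exists C; split=> // D DS DK.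
have /orP[//|CD] := cS _ _ DS CS.
have /eqP -> // : C == D by rewrite eqEcard CD; apply: Cmax; rewrite DS.
Qed.

Lemma chain_succ S K : chain S -> (exists2 C, C \in S & K \proper C) ->
  exists C, [/\ C \in S, K \proper C & {in S, forall D : {set 'I_n}, K \proper D -> C \subset D}].
Proof.
move=> cS [C0 C0S C0K].
have P0 : (C0 \in S) && (K \proper C0) by rewrite C0S.
case: (@arg_minnP _ C0 (fun C => (C \in S) && (K \proper C)) (fun C : {set 'I_n} => #|C|) P0).
move=> C /andP[CS CK] Cmin; exists C; split=> // D DS DK.
have /orP[//|DC] := cS _ _ CS DS.
have /eqP -> // : D == C by rewrite eqEcard DC; apply: Cmin; rewrite DS.
Qed.

Lemma gap_sum S G : chain S -> G \in S ->
  \sum_(K in S | K \subset G) gap S K = rho G.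
Proof.
move=> cS; have [m] := ubnP #|G|; elim: m G => // m IH G Gm GS.
rewrite (bigD1 G) ?GS ?subxx //=.
have [C|noC] := pickP (fun C => (C \in S) && (C \proper G)).
  case/andP=> CS CG; have [|D [DS DG Dmax]] := @chain_pred S G cS; first by exists C.
  rewrite -(gap_next DS DG Dmax) -(IH D) //; last first.
    by apply: leq_trans (proper_card DG) _; rewrite -ltnS.
  congr (_ + _); apply: eq_bigl => K; rewrite -andbA; case KS: (K \in S) => //=.
  rewrite andbC -properEneq; apply/idP/idP; first exact: Dmax.
  by move=> KD; apply: sub_proper_trans KD DG.
rewrite big1 ?addn0 => [|K /andP[/andP[KS KG] KnG]].
  by apply: gap_min => K KS; have := noC K; rewrite KS /= => ->.
by have := noC K; rewrite /= KS properEneq KnG KG.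
Qed.

Lemma gap_setT S K : gap (setT |: S) K = gap S K.
Proof.
congr (_ - _); apply: eq_bigl => C; rewrite !inE; case: eqP => //= ->.
by rewrite properE subsetT !andbF.
Qed.

Lemma chain_setT S : chain S -> chain (setT |: S).
Proof.
move=> cS F G /setU1P[->|FS] /setU1P[->|GS]; rewrite ?subsetT ?orbT //; exact: cS.
Qed.

Lemma gap_sum_all S : chain S -> setT \in S -> \sum_(K in S) gap S K = rho setT.
Proof.
by move=> cS TS; rewrite -(gap_sum cS TS); apply: eq_bigl => K; rewrite subsetT andbT.
Qed.

Lemma gap_sum_le S : chain S -> \sum_(K in S) gap S K <= rho setT.
Proof.
move=> cS; rewrite -(gap_sum_all (chain_setT cS)) ?setU11 //.
under [leqRHS]eq_bigr => K _ do rewrite gap_setT.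
have [TS|TS] := boolP (setT \in S); first by rewrite (setUidPr _) ?sub1set.
by rewrite [leqRHS]big_setU1 //= leq_addl.
Qed.

(** If [a] lies in the successor of [K] but not in [K], the members of the chain inside [K] are
    those missing [a]. The given sums are thus the partial sums along the chain, and their
    differences are the values. *)
Lemma chain_fun_inj S (f g : {set 'I_n} -> nat) : chain S -> setT \in S ->
  (forall K, K \notin S -> f K = 0) -> (forall K, K \notin S -> g K = 0) ->
  \sum_K f K = \sum_K g K ->
  (forall a, \sum_(K : {set 'I_n} | a \notin K) f K = \sum_(K : {set 'I_n} | a \notin K) g K) ->
  f =1 g.
Proof.
move=> cS TS f0 g0 eT ea K; have [m] := ubnP #|K|; elim: m K => // m IH K Km.
have [KS|KS] := boolP (K \in S); last by rewrite f0 ?g0.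
have low : \sum_(L : {set 'I_n} | L \proper K) f L = \sum_(L : {set 'I_n} | L \proper K) g L.
  apply: eq_bigr => L LK; apply: IH; apply: leq_trans (proper_card LK) _; by rewrite -ltnS.
suff /eqP : \sum_(L : {set 'I_n} | L \subset K) f L = \sum_(L : {set 'I_n} | L \subset K) g L.
  rewrite (bigD1 K) //= [X in _ == X](bigD1 K) //=.
  under eq_bigl => L do rewrite andbC -properEneq.
  under [X in _ == _ + X]eq_bigl => L do rewrite andbC -properEneq.
  by rewrite low eqn_add2r => /eqP.
have restr (h : {set 'I_n} -> nat) (P Q : pred {set 'I_n}) : (forall K, K \notin S -> h K = 0) ->
    {in S, P =1 Q} -> \sum_(L | P L) h L = \sum_(L | Q L) h L.
  move=> h0 PQ; rewrite [LHS](bigID (mem S)) [RHS](bigID (mem S)) /=.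
  rewrite [X in _ + X]big1 ?[X in _ = _ + X]big1 ?addn0; try by move=> L /andP[_ /h0].
  by apply: eq_bigl => L; case LS: (L \in S); rewrite ?andbF // PQ.
have [->|KT] := eqVneq K setT.
  by under eq_bigl => L do rewrite subsetT; under [RHS]eq_bigl => L do rewrite subsetT.
have [|C [CS /properP[KC [a aC aK]] Cmin]] := @chain_succ S K cS.
  by exists setT => //; rewrite properT.
have aE : {in S, (fun L : {set 'I_n} => L \subset K) =1 (fun L => a \notin L)}.
  move=> L LS; apply/idP/idP => [LK|]; first by apply: contra aK; apply: subsetP.
  apply: contraR => LK; have KL := chain_proper cS LS KS LK.
  exact: subsetP (Cmin _ LS KL) _ aC.
by rewrite (restr f _ _ f0 aE) (restr g _ _ g0 aE).
Qed.

(** * Normal monomials *)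

Definition supp (m : {set 'I_n} -> nat) : {set {set 'I_n}} := [set K | m K != 0].

(* The monomials of the Feichtner-Yuzvinsky basis ([e = 1]) and of its augmented analogue ([e = 0]). *)
Definition fy_normal (m : {set 'I_n} -> nat) : bool :=
  [forall G, (m G != 0) ==>
    [&& nzflat G, m G < rho G &
      [forall C, (m C != 0) ==> ((C \subset G) || (G \subset C)) &&
         ((C \proper G) ==> (m G + rho C < rho G))]]].

Lemma fy_normalP m : reflect
  [/\ forall G, m G != 0 -> nzflat G, chain (supp m) &
      forall G, m G != 0 -> m G < gap (supp m) G] (fy_normal m).
Proof.
apply: (iffP forallP) => [H|[H1 H2 H3] G].
  split=> [G mG|F G|G mG].
  - by have /implyP/(_ mG)/and3P[] := H G.
  - rewrite !inE => mF mG; have /implyP/(_ mG)/and3P[_ _ /forallP/(_ F)] := H G.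
    by rewrite mF => /andP[].
  have /implyP/(_ mG)/and3P[_ mr /forallP H'] := H G; apply: lt_gap => // C.
  by rewrite inE => mC CG; have := H' C; rewrite mC /= CG => /andP[].
apply/implyP => mG; rewrite H1 // (leq_trans (H3 _ mG) (gap_rho _ _)) /=.
apply/forallP => C; apply/implyP => mC; rewrite H2 ?inE //=.
apply/implyP => CG; apply: leq_trans (gap_lt (S := supp m) _ CG); last by rewrite inE.
by rewrite -addSn leq_add2r H3.
Qed.

(** A bound fails because of the flat alone or because of a smaller member of [S]; [upsum_pow] and
    [x_upsum_pow] answer these two cases. [S] may exceed the support of [m], so that a fixed flat
    can take part in the chain. *)
Lemma gap_trichotomy m S :
  [\/ exists2 G, m G != 0 & rho G <= m G,
      exists G C, [/\ m G != 0, C \in S, C \proper G & rho G <= m G + rho C] |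
      forall G, m G != 0 -> m G < gap S G].
Proof.
have [/existsP[G /andP[]]|/existsPn H1] := boolP [exists G, (m G != 0) && (rho G <= m G)].
  by constructor 1; exists G.
have [/existsP[G /existsP[C /and4P[]]]|/existsPn H2] := boolP [exists G, exists C,
    [&& m G != 0, C \in S, C \proper G & rho G <= m G + rho C]].
  by constructor 2; exists G, C.
constructor 3 => G mG; apply: lt_gap => [|C CS CG]; first by have := H1 G; rewrite mG -ltnNge.
by have /existsPn/(_ C) := H2 G; rewrite mG CS CG -ltnNge.
Qed.

End Gaps.

(** * Rings satisfying the Chow relations *)

Section ChowRelations.
Variables (n : nat) (Ind : {set {set 'I_n}}) (e : nat).
Hypotheses (HM : is_matroid Ind) (HL : loopless Ind) (e1 : e <= 1).
Variables (A : comNzRingType) (x : {set 'I_n} -> A).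
Local Notation r := (mrank Ind).
Local Notation flat := (is_flat Ind).
Local Notation nzflat := (nonempty_flat Ind).
Local Notation k := (matroid_rank Ind).
Local Notation rho := (shifted_rank Ind e).
Local Notation gap := (rank_gap Ind e).
Local Notation mon := (xmon x).
Local Notation cl := (mclosure Ind).
Implicit Types (F G K C : {set 'I_n}) (S : {set {set 'I_n}}) (m : {set 'I_n} -> nat).
Local Open Scope ring_scope.

Definition upsum G : A := \sum_(K | flat K && (G \subset K)) x K.
Local Notation h := upsum.

Hypothesis x_incomp : forall F G, nzflat F -> nzflat G -> ~~ (F \subset G) -> ~~ (G \subset F) ->
  x F * x G = 0.
Hypothesis h1_x : forall (a : 'I_n) F, nzflat F -> a \notin F -> h [set a] * x F = 0.
Hypothesis h1_pow : forall a : 'I_n, h [set a] ^+ (2 - e) = 0.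

Lemma nzflatS F G : flat G -> nzflat F -> F \subset G -> nzflat G.
Proof.
move=> fG /andP[_ F0] FG; rewrite /nzflat fG; apply: contra F0 => /eqP G0.
by rewrite -subset0 -G0.
Qed.

Lemma nzflat_mem F a : flat F -> a \in F -> nzflat F.
Proof. by move=> fF aF; rewrite /nzflat fF; apply/set0Pn; exists a. Qed.

Lemma upsum_split G a : h G = h (a |: G) + \sum_(K | [&& flat K, G \subset K & a \notin K]) x K.
Proof.
rewrite /h (bigID (fun K : {set 'I_n} => a \in K)) /=; congr (_ + _).
  by apply: eq_bigl => K; rewrite subUset sub1set -andbA [(_ \in _) && _]andbC.
by apply: eq_bigl => K; rewrite -andbA.
Qed.

Lemma upsum_eq G G' : G \subset G' -> r G = r G' -> h G = h G'.
Proof.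
move=> GG' rG; apply: eq_bigl => K; case fK: (flat K) => //=.
apply/idP/idP => [GK|]; last exact: subset_trans.
apply: subset_trans (cl_min HM fK GK); apply/subsetP => a aG'; rewrite inE eqn_leq.
by rewrite [X in _ && X]mrankS ?subsetUr // andbT rG mrankS // subUset sub1set aG'.
Qed.

(** In [h [set a] * x K] the terms [x L] with [G] not inside [L] vanish: [L] contains [a] and [K]
    does not, [K] contains [G] and [L] does not, so they are incomparable. What remains is the
    claimed product. *)
Lemma upsum_x G a K : nzflat K -> G \subset K -> a \notin K -> h (a |: G) * x K = 0.
Proof.
move=> nK GK aK; have /eqP := h1_x nK aK; rewrite /h big_distrl /=.
rewrite (bigID (fun L : {set 'I_n} => G \subset L)) /= addrC big1 ?add0r => [/eqP E|L].
  rewrite /h big_distrl /= -[RHS]E; apply: eq_bigl => L.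
  by rewrite subUset -andbA.
case/andP=> /andP[fL aL] GL; rewrite sub1set in aL; apply: x_incomp => //.
- exact: nzflat_mem aL.
- by apply: contra aK => /subsetP; apply.
- by apply: contra GL => KL; apply: subset_trans KL.
Qed.

Lemma upsum_sq G a : G != set0 -> h (a |: G) * h (a |: G) = h (a |: G) * h G.
Proof.
move=> G0; rewrite [in RHS](upsum_split G a) mulrDr.
set s := (X in _ + _ * X); suff -> : h (a |: G) * s = 0 by rewrite addr0.
rewrite big_distrr big1 //.
move=> K /and3P[fK GK aK]; apply: upsum_x => //.
by rewrite /nzflat fK; apply: contra G0 => /eqP K0; rewrite -subset0 -K0.
Qed.

(** A new point either keeps the rank, and then [h] is unchanged, or raises it by one; in that case
    [upsum_sq] gives [h (a |: G) ^+ c.+1 = h (a |: G) * h G ^+ c], so one more power suffices. *)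
Lemma upsum_pow_climb (Y : A) (B0 B : {set 'I_n}) d : B0 != set0 -> B0 \subset B -> Y * h B0 ^+ d.+1 = 0 ->
  Y * h B ^+ (d.+1 + r B - r B0) = 0.
Proof.
move=> B00 B0B Y0; have [m] := ubnP #|B|; elim: m B B0B => // m IH B B0B Bm.
have [<-|BB0] := eqVneq B0 B; first by rewrite addnK.
have /properP[_ [a aB aB0]] : B0 \proper B by rewrite properEneq BB0.
have B0B' : B0 \subset B :\ a by rewrite subsetD1 B0B.
have {}IH := IH _ B0B'; rewrite (cardsD1 a B) aB add1n ltnS in Bm; have {}IH := IH Bm.
have r0 : (r B0 <= r (B :\ a))%N by rewrite mrankS.
have [rE|rN] := eqVneq (r (B :\ a)) (r B).
  by rewrite -(upsum_eq _ rE) ?subsetDl // -rE.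
have {rN} rE : r B = (r (B :\ a)).+1.
  apply/eqP; rewrite eqn_leq ltn_neqAle rN [X in _ && X]mrankS ?subsetDl // andbT.
  by rewrite -[X in (mrank _ X <= _)%N](setD1K aB) mrankU1.
have -> : (d.+1 + r B - r B0 = (d.+1 + r (B :\ a) - r B0).+1)%N by lia.
have : (0 < d.+1 + r (B :\ a) - r B0)%N by lia.
set c := (d.+1 + _ - _)%N in IH *; clearbody c; move: IH.
rewrite -{2}(setD1K aB); set G := B :\ a.
have G0 : G != set0 by apply: contra B00 => /eqP G0; rewrite -subset0 -G0.
have sq := upsum_sq a G0 => IH c0.
suff -> : h (a |: G) ^+ c.+1 = h (a |: G) * h G ^+ c by rewrite mulrCA IH mulr0.
elim: (c) => [|c' IHc]; first by rewrite expr1 expr0 mulr1.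
by rewrite exprS IHc exprS mulrA sq -mulrA.
Qed.

Lemma x_upsum_pow F (B : {set 'I_n}) : nzflat F -> F \proper B -> x F * h B ^+ (r B - r F) = 0.
Proof.
move=> nF /properP[FB [a aB aF]]; have /andP[fF F0] := nF.
have FaB : a |: F \subset B by rewrite subUset sub1set aB.
have r1 : r (a |: F) = (r F).+1 by apply/eqP; rewrite eqn_leq mrankU1 // flatP.
have := @upsum_pow_climb (x F) (a |: F) B 0 _ FaB; rewrite r1 expr1 mulrC => H.
have <- : (1 + r B - (r F).+1 = r B - r F)%N by lia.
apply: H; last exact: upsum_x.
by apply/set0Pn; exists a; rewrite setU11.
Qed.

(** The climb starts at a single point with exponent [2 - e] and ends with
    [2 - e + r B - 1 = rho B]. *)
Lemma upsum_pow (B : {set 'I_n}) : B != set0 -> h B ^+ rho B = 0.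
Proof.
move=> /set0Pn[a aB].
have := @upsum_pow_climb 1 [set a] B (1 - e); rewrite !mul1r sub1set mrank1 //.
have -> : ((1 - e).+1 + r B - 1 = rho B)%N by rewrite /shifted_rank; lia.
apply=> //; first by apply/set0Pn; exists a; rewrite inE.
by rewrite -[RHS](h1_pow a); congr (_ ^+ _); lia.
Qed.

(** * Straightening monomials towards larger flats *)

Section Reduce.
Variables (Q : pred {set 'I_n}) (Y : A) (N : ({set 'I_n} -> nat) -> Prop).
Hypothesis Qflat : forall F, Q F -> flat F.
Hypothesis Qup : forall F G, Q F -> flat G -> F \subset G -> Q G.
Hypothesis step : forall m, (forall F, m F != 0%N -> Q F) ->
  [\/ N m, Y * mon m = 0 | exists G d, [/\ (0 < d <= m G)%N & Y * mon (drp m G d) * h G ^+ d = 0]].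

(** [N] is the stopping condition. The fixed factor [Y] and the upward closed class [Q] allow the
    same rewriting inside the multiples of some [x F], as in [x_mon_above]. *)
Lemma mon_reduce m : (forall F, m F != 0%N -> Q F) ->
  zspan (fun a => exists m', [/\ forall F, m' F != 0%N -> Q F, deg m' = deg m, N m' & a = Y * mon m'])
    (Y * mon m).
Proof.
have [c] := ubnP (n * deg m - wt m); elim: c m => // c IH m mc mQ.
have [Nm|->|[G [d [/andP[d0 dm] Y0]]]] := step mQ.
- by apply: zspan_gen; exists m.
- exact: zspan0.
have QG : Q G by apply: mQ; rewrite -lt0n; apply: leq_trans dm.
have := subrXX (x G) (h G) d; set rest := \sum_(i < d) _ => eX.
have xS c' : zspan (monset x Q c' (c' * #|G|)) (x G ^+ c').
  by apply: zspan_gen; apply: monset_dlt.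
have hS : zspan (monset x Q 1 #|G|) (h G).
  apply: zspan_sum => K /andP[fK GK]; apply: zspan_gen; rewrite -[x K]expr1.
  by apply: monset_dlt; rewrite ?mul1n ?subset_leq_card //; apply: Qup GK.
have hS' : zspan (monset x Q 1 #|G|.+1) (h G - x G).
  rewrite /h (bigD1 G) /=; last by rewrite subxx Qflat.
  rewrite addrAC subrr add0r; apply: zspan_sum => K /andP[/andP[fK GK] KG].
  apply: zspan_gen; rewrite -[x K]expr1; apply: monset_dlt; first exact: Qup GK.
  by rewrite mul1n proper_card // properEneq eq_sym KG.
have restS : zspan (monset x Q d.-1 (d.-1 * #|G|)) rest.
  apply: zspan_sum => i _; have id := ltn_ord i.
  have := zspan_mul (fun a b => @monset_mul _ _ x Q _ _ _ _ a b) (xS (d.-1 - i)%N) (zspan_monset_exp i hS).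
  by rewrite muln1 -mulnDl subnK //; lia.
have dropS : zspan (monset x Q (deg m - d) (wt m - d * #|G|)) (mon (drp m G d)).
  have dE := deg_ext (drpK dm); rewrite degD deg_dlt in dE.
  have wE : wt m = (wt (drp m G d) + d * #|G|)%N.
    by rewrite -wt_dlt -wtD; apply: eq_bigr => K _; rewrite (drpK dm K).
  apply: zspan_gen; exists (drp m G d); rewrite dE wE !addnK; split=> // K.
  by move=> mK; apply: mQ; apply: contra mK => /eqP mK; rewrite /drp mK.
have d_deg : (d <= deg m)%N by rewrite (deg_ext (drpK dm)) degD deg_dlt leq_addl.
have d_wt : (d * #|G| <= wt m)%N.
  by rewrite /wt (bigD1 G) //= (leq_trans _ (leq_addr _ _)) // leq_mul2r dm orbT.
(* [x G ^+ d - h G ^+ d] has the factor [x G - h G], and the power of [h G] is killed by [Y0]. Only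
   flats strictly above [G] occur in [h G - x G], so the weight goes up. *)
have -> : Y * mon m = - (Y * (mon (drp m G d) * ((h G - x G) * rest))).
  rewrite -mulrN -mulrN -mulNr opprB -eX (mon_drp x dm) mulrBr mulrBr.
  by rewrite [X in _ - X]mulrA Y0 subr0.
apply: zspan_opp; set b := _ * (_ * rest).
have : zspan (monset x Q (deg m) (wt m).+1) b.
  have M i j s t := fun a b => @monset_mul _ _ x Q i j s t a b.
  have := zspan_mul (M _ _ _ _) dropS (zspan_mul (M _ _ _ _) hS' restS).
  rewrite add1n prednK // subnK //; congr zspan; congr monset.
  by case: (d) d0 d_wt => // d' _; rewrite mulSn /=; lia.
move=> bS; apply: (@zspan_bind _ _ (Y \*o idfun) _ _ _ _ bS) => _ [m' [m'Q m'd m'w ->]] /=.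
rewrite -m'd; apply: IH => //.
have := wt_le m; have := wt_le m'; rewrite m'd card_ord; lia.
Qed.
End Reduce.

Implicit Type c d : nat.

Lemma mon_chain m : (forall F, m F != 0%N -> nzflat F) -> mon m != 0 -> chain (supp m).
Proof.
move=> mf mon0 F G; rewrite !inE => mF mG; apply: contraNT mon0; rewrite negb_or => /andP[FG GF].
apply/eqP; apply: (mon_eq0 mF mG); last by apply: x_incomp; rewrite ?mf.
by apply: contra FG => /eqP ->.
Qed.

Lemma mon_violation m C G : nzflat C -> m C != 0%N -> C \proper G ->
  mon (drp m G (r G - r C)) * h G ^+ (r G - r C) = 0.
Proof.
move=> nC mC CG; rewrite (@mon_drp _ _ x _ C 1).
  by rewrite expr1 -mulrA x_upsum_pow // mulr0.
by rewrite /drp /dlt (negPf (proper_neq CG)) mul0n subn0 lt0n.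
Qed.

Lemma rho_sub F G : (rho G - rho F = r G - r F)%N.
Proof. by rewrite subnDr. Qed.

Lemma mon_span m : (forall F, m F != 0%N -> nzflat F) ->
  zspan (fun a => exists m', [/\ deg m' = deg m, fy_normal Ind e m' & a = mon m']) (mon m).
Proof.
move=> mf; have := @mon_reduce nzflat 1 (fun m' => fy_normal Ind e m') _ _ _ m mf; rewrite mul1r => H.
apply: (@zspan_bind _ _ idfun _ _ _ _ (H _ _ _)) => [a|F /andP[]//|F G nF fG FG|m' m'f].
- move=> [m' [_ d' N' ->]]; by apply: zspan_gen; exists m'; rewrite mul1r.
- exact: nzflatS FG.
- rewrite mul1r; have [->|mon0] := eqVneq (mon m') 0; first by constructor 2.
  have cm := mon_chain m'f mon0.
  case: (gap_trichotomy Ind e m' (supp m')) => [[G mG le]|[G [C [mG CS CG le]]]|gm'].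
  - constructor 3; exists G, (rho G); have /andP[_ G0] := m'f _ mG.
    by rewrite mul1r upsum_pow // mulr0 le rho_gt0.
  - rewrite inE in CS; constructor 3; exists G, (r G - r C)%N.
    rewrite mul1r mon_violation ?m'f //; split=> //.
    have /andP[fC _] := m'f _ CS; have := mrank_proper HM fC CG.
    by have := rho_sub C G; move: le; rlia.
  - by constructor 1; apply/(fy_normalP e HM).
Qed.

(* Above a proper flat [F] the Chow ring is that of the contraction, which vanishes in degree
   [k - r F]. *)
Lemma x_mon_above F m : nzflat F -> F != setT -> (forall K, m K != 0%N -> flat K && (F \proper K)) ->
  (k - r F <= deg m)%N -> x F * mon m = 0.
Proof.
move=> nF FT mF dm; have /andP[fF F0] := nF.
(* Straightening preserves the degree but is made to stop only below degree [k - r F], so by [dm]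
   there is no generator left and the span is zero. *)
have := @mon_reduce (fun K => flat K && (F \proper K)) (x F) (fun m' => deg m' < k - r F)%N _ _ _ m mF.
have up K : flat K && (F \proper K) -> nzflat K.
  by case/andP=> fK /proper_sub; apply: nzflatS.
move=> H; apply: zspan_empty (H _ _ _); last first.
- move=> m' m'F; have m'f K : m' K != 0%N -> nzflat K by move/m'F/up.
  have [->|mon0] := eqVneq (mon m') 0; first by rewrite mulr0; constructor 2.
  have cm := mon_chain m'f mon0; pose S := F |: supp m'.
  have fS : {in S, forall K, flat K}.
    by move=> K /setU1P[->//|]; rewrite inE => /m'F/andP[].
  have cS : chain S.
    move=> K L /setU1P[->|KS] /setU1P[->|LS]; last exact: cm.
    - by rewrite subxx.
    - by move: LS; rewrite inE => /m'F/andP[_ /proper_sub->].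
    - by move: KS; rewrite inE => /m'F/andP[_ /proper_sub->]; rewrite orbT.
  case: (gap_trichotomy Ind e m' S) => [[G mG le]|[G [C [mG CS CG le]]]|gm'].
  - constructor 3; exists G, (r G - r F)%N; have /andP[fG FG] := m'F _ mG.
    rewrite mulrAC x_upsum_pow // mul0r; split=> //.
    have := mrank_proper HM fF FG; have := rho_sub F G; move: le.
    by rewrite /shifted_rank; rlia.
  - constructor 3; exists G, (r G - r C)%N; split.
      have := mrank_proper HM (fS _ CS) CG; have := rho_sub C G; move: le; rlia.
    case/setU1P: CS CG => [->|]; first by move=> FG; rewrite mulrAC x_upsum_pow // mul0r.
    by rewrite inE => mC CG; rewrite -mulrA mon_violation ?mulr0 // m'f.
  (* Here every exponent is strictly below its gap. The gaps of [S] sum to at most [rho setT] and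
     [F] takes [rho F] of it, so a nonempty support has degree below [k - r F]. *)
  - constructor 1; have [S0|[G0 G0S]] := set_0Vmem (supp m').
      rewrite /deg big1 ?subn_gt0 ?mrank_flat_lt // => K _.
      by apply/eqP; apply: contraT => mK; have := in_set0 K; rewrite -S0 inE mK.
    have mF0 : m' F = 0%N.
      by apply/eqP; apply: contraT => /m'F; rewrite properxx andbF.
    have gF : gap S F = rho F.
      by apply: gap_min => C /setU1P[->|]; rewrite ?properxx // inE => /m'F/andP[_ /proper_sub];
         rewrite properE => ->; rewrite andbF.
    have := gap_sum_le e HM cS; rewrite big_setU1 ?inE ?mF0 //= gF.
    have -> : deg m' = (\sum_(K in supp m') m' K)%N.
      rewrite /deg [RHS]big_mkcond; apply: eq_bigr => K _; rewrite inE.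
      by case: eqP => // ->.
    have : (\sum_(K in supp m') (m' K + 1) <= \sum_(K in supp m') gap S K)%N.
      by apply: leq_sum => K; rewrite inE addn1; apply: gm'.
    rewrite big_split /= sum1_card.
    have : (0 < #|supp m'|)%N by apply/card_gt0P; exists G0.
    have := rhoS e HM (subsetT F); rewrite /shifted_rank.
    have -> : r setT = k by [].
    set a := (\sum_(K in supp m') m' K)%N; set b := (\sum_(K in supp m') gap S K)%N; set c := #|supp m'|.
    by move: a b c; rlia.
- by move=> K G /andP[fK FK] fG KG; rewrite fG (proper_sub_trans FK KG).
- by move=> K /andP[].
- by move=> b [m' [_ m'd lt _]]; move: lt; rewrite m'd ltnNge dm.
Qed.


(** * Dual monomials and the top degree *)

Lemma mon_split m (P : pred {set 'I_n}) :
  mon m = mon (fun K => if P K then m K else 0%N) * mon (fun K => if P K then 0%N else m K).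
Proof.
by rewrite -monD; apply: mon_ext => K; case: (P K); rewrite ?addn0.
Qed.

Lemma mon_above_eq0 m F : (forall K, m K != 0%N -> nzflat K) -> F != setT -> m F != 0%N ->
  (k - r F <= \sum_(K : {set 'I_n} | F \proper K) m K)%N -> mon m = 0.
Proof.
move=> mf FT mF le; rewrite (mon_split m (fun K => F \proper K)) mulrC.
rewrite (@mon_drp _ _ x _ F 1) ?properxx ?lt0n // expr1 -mulrA x_mon_above ?mulr0 ?mf //.
  by move=> K; case: ifP => // _ /mf/andP[->].
by rewrite /deg -big_mkcond.
Qed.

(** Taking one off at [setT] brings the degree, for a chain through [setT], to the top degree
    [k - e]. *)
Definition gap_mon S K := if K \in S then (gap S K - (K == setT))%N else 0%N.

Definition dual (v : {set 'I_n} -> nat) K :=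
  if K \in setT |: supp v then (gap (supp v) K - (K == setT) - v K)%N else 0%N.

Hypothesis T0 : [set: 'I_n] != set0.

Lemma nzflatT : nzflat setT.
Proof. by rewrite /nonempty_flat T0 flatT. Qed.

Lemma add_dual v K : fy_normal Ind e v -> (v K + dual v K)%N = gap_mon (setT |: supp v) K.
Proof.
move=> /(fy_normalP e HM)[vf cv vg]; rewrite /dual /gap_mon gap_setT !inE.
have [vK|vK] := eqVneq (v K) 0%N.
  by rewrite vK add0n subn0.
rewrite orbT subnKC //; have h := vg _ vK.
by apply: leq_trans (leq_sub2l _ (leq_b1 _)); rewrite subn1 -ltnS (ltn_predK h).
Qed.

Lemma gap_mon_sum S G : chain S -> setT \in S -> {in S, forall K, nzflat K} -> G \in S -> G != setT ->
  (\sum_(K : {set 'I_n} | K \subset G) gap_mon S K)%N = rho G.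
Proof.
move=> cS TS fS GS GT; rewrite -(gap_sum e HM cS GS) [RHS]big_mkcondl /=.
apply: eq_bigr => K KG; rewrite /gap_mon; case: ifP => // _.
case: eqP => [KT|_]; last by rewrite subn0.
by move: KG; rewrite KT subTset (negPf GT).
Qed.

Lemma gap_mon_deg S : chain S -> setT \in S -> {in S, forall K, nzflat K} ->
  (deg (gap_mon S)).+1 = rho setT.
Proof.
move=> cS TS fS; rewrite -(gap_sum_all e HM cS TS) /deg (bigD1 setT) //= [RHS](bigD1 setT) //=.
rewrite {1}/gap_mon TS eqxx -addSn subn1 prednK; last first.
  by apply: gap_gt0 => // K /fS/andP[].
congr (_ + _)%N; rewrite [RHS]big_mkcondl /=; apply: eq_bigr => K /negPf KT.
by rewrite /gap_mon KT subn0.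
Qed.

(** * Triangularity of the pairing *)

Section Compare.
Variables v w : {set 'I_n} -> nat.
Hypotheses (vN : fy_normal Ind e v) (wN : fy_normal Ind e w) (vw : deg w = deg v).
Hypothesis nz : mon (fun K => w K + dual v K)%N != 0.

Let u K := (w K + dual v K)%N.
Let Sv := setT |: supp v.

Lemma supp_setT_chain : chain Sv.
Proof. by apply: chain_setT; case/(fy_normalP e HM): vN. Qed.

Lemma supp_setT_nzflat : {in Sv, forall K, nzflat K}.
Proof.
move=> K /setU1P[->|]; first exact: nzflatT.
by rewrite inE; case/(fy_normalP e HM): vN => h _ _; apply: h.
Qed.

Lemma product_nzflat K : u K != 0%N -> nzflat K.
Proof.
rewrite /u addn_eq0 negb_and => /orP[|]; first by case/(fy_normalP e HM): wN => h _ _; apply: h.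
by rewrite /dual; case: ifP => // KS _; apply: supp_setT_nzflat.
Qed.

Lemma product_chain : chain (supp u).
Proof. by apply: mon_chain nz; apply: product_nzflat. Qed.

Lemma product_deg : (deg u).+1 = rho setT.
Proof.
rewrite degD vw -degD -(gap_mon_deg supp_setT_chain) ?setU11 //; last exact: supp_setT_nzflat.
by congr _.+1; apply: deg_ext => K; rewrite add_dual.
Qed.

(** For [G] proper, [mon u != 0] leaves degree less than [k - r G] strictly above [G], hence at
    least [rho G] inside [G] out of the total [k - e]. As [v] and its dual together have exactly
    [rho G] inside [G], cancelling the dual gives the claim. *)
Lemma dominance G : v G != 0%N ->
  (\sum_(K : {set 'I_n} | K \subset G) v K <= \sum_(K : {set 'I_n} | K \subset G) w K)%N.
Proof.
move=> vG; have [->|GT] := eqVneq G setT.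
  have Tx (f : {set 'I_n} -> nat) : (\sum_(K : {set 'I_n} | K \subset setT) f K = deg f)%N.
    by apply: eq_bigl => K; rewrite subsetT.
  by rewrite !Tx vw.
have GSv : G \in Sv by rewrite !inE vG orbT.
have uG : u G != 0%N.
  have [_ _ /(_ _ vG)] := fy_normalP e HM _ vN.
  rewrite /u /dual !inE vG orbT (negPf GT) subn0 addn_eq0 negb_and; lia.
have split_deg : (deg u = \sum_(K : {set 'I_n} | K \subset G) u K + \sum_(K : {set 'I_n} | G \proper K) u K)%N.
  rewrite /deg (bigID (fun K : {set 'I_n} => K \subset G)) /=; congr (_ + _)%N.
  rewrite [LHS]big_mkcond [RHS]big_mkcond; apply: eq_bigr => K _.
  case: (eqVneq (u K) 0%N) => [->|uK]; first by case: ifP; case: ifP.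
  have [Ku Gu] : K \in supp u /\ G \in supp u by rewrite !inE.
  have /orP[KG|GK] := product_chain Ku Gu.
    by rewrite KG /= properE KG andbF.
  by rewrite properE GK.
have : (\sum_(K : {set 'I_n} | G \proper K) u K < k - r G)%N.
  rewrite ltnNge; apply: contra nz => le; apply/eqP.
  exact: (mon_above_eq0 product_nzflat GT uG).
have := gap_mon_sum supp_setT_chain (setU11 _ _) supp_setT_nzflat GSv GT.
under eq_bigr => K _ do rewrite -(add_dual K vN).
move: split_deg; have := product_deg; rewrite /u !big_split /=.
have := rhoS e HM (subsetT G); rewrite /shifted_rank; have -> : r setT = k by [].
set a1 := (\sum_(K : {set 'I_n} | K \subset G) w K)%N; set a2 := (\sum_(K : {set 'I_n} | K \subset G) v K)%N.
set a3 := (\sum_(K : {set 'I_n} | K \subset G) _)%N; set a4 := (\sum_(K : {set 'I_n} | G \proper K) w K)%N.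
set a5 := (\sum_(K : {set 'I_n} | G \proper K) _)%N; set a6 := deg _.
by move: a1 a2 a3 a4 a5 a6; rlia.
Qed.

(** Let [G] be the largest support member of [v] missing [a]. By the chain condition all other such
    members lie inside [G], and conversely every subset of [G] misses [a], so [dominance] at [G]
    applies. *)
Lemma codominance a :
  (\sum_(K : {set 'I_n} | a \notin K) v K <= \sum_(K : {set 'I_n} | a \notin K) w K)%N.
Proof.
have cv : chain (supp v) by case/(fy_normalP e HM): vN.
have [G0 /andP[vG0 aG0]|no] := pickP (fun G : {set 'I_n} => (v G != 0%N) && (a \notin G)); last first.
  rewrite big1 // => K aK; apply/eqP; apply: contraT => vK.
  by have := no K; rewrite /= vK aK.
have P0 : (v G0 != 0%N) && (a \notin G0) by rewrite vG0.
case: (@arg_maxnP _ G0 (fun G : {set 'I_n} => (v G != 0%N) && (a \notin G)) (fun G : {set 'I_n} => #|G|) P0).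
move=> G /andP[vG aG] Gmax; apply: (@leq_trans (\sum_(K : {set 'I_n} | K \subset G) v K)%N).
  rewrite big_mkcond [leqRHS]big_mkcond /=; apply: leq_sum => K _.
  case: ifP => // aK; case: (eqVneq (v K) 0%N) => [->//|vK].
  have [Kv Gv] : K \in supp v /\ G \in supp v by rewrite !inE.
  have /orP[->//|GK] := cv K G Kv Gv.
  have /eqP <- : G == K by rewrite eqEcard GK; apply: Gmax; rewrite vK.
  by rewrite subxx.
apply: leq_trans (dominance vG) _.
rewrite big_mkcond [leqRHS]big_mkcond /=; apply: leq_sum => K _.
case: ifP => // KG; rewrite ifT //; apply: contra aG; exact: subsetP.
Qed.

(** This is the sum of [(n - #|K|) * f K], written point by point so that equality of coweights
    forces equality in [codominance] for each [a]. It orders the triangular matrix. *)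
Definition coweight (f : {set 'I_n} -> nat) := (\sum_a \sum_(K : {set 'I_n} | a \notin K) f K)%N.

Lemma coweight_le : (coweight v <= coweight w)%N.
Proof. by apply: leq_sum => a _; apply: codominance. Qed.

Lemma coweight_eq : (coweight w <= coweight v)%N -> w =1 v.
Proof.
move=> le; have /eqP eqc : coweight v == coweight w by rewrite eqn_leq coweight_le.
have sums a : (\sum_(K : {set 'I_n} | a \notin K) w K = \sum_(K : {set 'I_n} | a \notin K) v K)%N.
  have aux (p q s t : nat) : (p + s = q + t -> s <= t -> p <= q -> q = p)%N by lia.
  move: eqc; rewrite /coweight (bigD1 a) //= [RHS](bigD1 a) //= => E.
  by apply: aux E _ (codominance a); apply: leq_sum => b _; apply: codominance.
apply: (@chain_fun_inj _ (setT |: supp u)) sums => //.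
- by apply: chain_setT; apply: product_chain.
- by rewrite setU11.
- by move=> K; rewrite !inE negb_or negbK /u addn_eq0 => /andP[_ /andP[/eqP]].
move=> K; rewrite !inE negb_or negbK /u addn_eq0 => /andP[KT /andP[_ d0]].
apply/eqP; apply: contraTT d0 => vK; have [_ _ /(_ _ vK)] := fy_normalP e HM _ vN.
by rewrite /dual !inE vK orbT (negPf KT) subn0; lia.
Qed.

End Compare.

(** The induction deletes the lowest flat [F] and moves its exponent to the next flat [G]. On the
    product [Y] of the other factors, [h F] acts as [x F + x G] and [x F * x G] as zero, so
    [h F ^+ rho F = 0] exchanges [x F ^+ rho F] for [x G ^+ rho F] with a change of sign. *)
Lemma gap_mon_top S : chain S -> setT \in S -> {in S, forall K, nzflat K} ->
  exists b : bool, mon (gap_mon S) = (-1) ^+ b * x setT ^+ (rho setT).-1.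
Proof.
have [c] := ubnP #|S|; elim: c S => // c IH S Sc cS TS fS.
have [S1|[F FS FT]] : S = [set setT] \/ exists2 F, F \in S & F != setT.
  have [/existsP[F /andP[FS FT]]|/existsPn H] := boolP [exists F, (F \in S) && (F != setT)].
    by right; exists F.
  left; apply/setP => K; rewrite inE; apply/idP/eqP => [KS|->//].
  by apply/eqP; have := H K; rewrite KS negbK.
  exists false; rewrite mul1r S1 -(mon_dlt x setT); apply: mon_ext => K.
  rewrite /gap_mon /dlt inE; case: eqP => [->|_]; rewrite ?mul0n // mul1n.
  rewrite gap_min ?subn1 // => C; by rewrite inE => /eqP ->; rewrite properxx.
have [B [BS Bmin] BT] : exists2 B : {set 'I_n}, B \in S /\ {in S, forall D : {set 'I_n}, B \subset D} & B != setT.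
  have pr0 K : K \in S -> set0 \proper K by move=> /fS/andP[_]; rewrite proper0.
  have [|F0 [F0S F00 F0min]] := @chain_succ _ S set0 cS; first by exists F; rewrite ?pr0.
  exists F0; first by split=> // D DS; apply: F0min; rewrite ?pr0.
  by apply: contraNneq FT => F0T; rewrite -subTset -F0T; apply: F0min; rewrite ?pr0.
move: B BS Bmin BT => {F FS FT}F FS Fmin FT.
have [|G [GS FG Gmin]] := @chain_succ _ S F cS; first by exists setT; rewrite ?properT.
have /andP[fF F0] := fS _ FS; have [fG G0] := andP (fS _ GS).
have GF : G != F by rewrite eq_sym (proper_neq FG).
pose S' := S :\ F; pose Y K := if K \in S' then (gap S K - (K == setT))%N else 0%N.
have S'P K : K \in S' -> [/\ K \in S, K != F & G \subset K].
  rewrite !inE => /andP[KF KS]; split=> //; apply: Gmin => //.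
  by rewrite properEneq eq_sym KF Fmin.
have gapF : gap S F = rho F.
  by apply: gap_min => C CS; rewrite properE (Fmin _ CS) andbF.
have gapG : (gap S G + rho F = rho G)%N.
  apply: (gap_next e HM FS FG) => D DS DG; have [->//|DF] := eqVneq D F.
  by have [_ _] := S'P D (ltac:(by rewrite !inE DF)); rewrite (negPf (proper_subn DG)).
have gapG0 : (0 < gap S G)%N by apply: gap_gt0 => // K /fS/andP[].
have gap'G : gap S' G = rho G.
  by apply: gap_min => C /S'P[_ _ GC]; rewrite properE GC andbF.
have gap'K K : K \in S' -> K != G -> gap S' K = gap S K.
  move=> KS' KG; have [KS KF GK] := S'P _ KS'.
  have GpK : G \proper K by rewrite properEneq eq_sym KG.
  have [|C [CS CK Cmax]] := @chain_pred _ S K cS; first by exists G.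
  have CF : C != F.
    by apply: contraTneq FG => CF; rewrite properE -CF Cmax ?andbF.
  apply: (@addIn (rho C)); rewrite (gap_next e HM CS CK Cmax) (gap_next e HM _ CK) ?inE ?CF //.
  by move=> D /S'P[DS _ _]; apply: Cmax.
have YF : Y F = 0%N by rewrite /Y !inE eqxx.
have YG : Y G = (gap S G - (G == setT))%N by rewrite /Y !inE GF GS.
have YP K : Y K != 0%N -> K \in S' by rewrite /Y; case: ifP.
have YG' K : Y K != 0%N -> G \subset K by move/YP/S'P => [].
have Ynz K : Y K != 0%N -> nzflat K by move/YP/S'P => [/fS].
have monS : mon (gap_mon S) = mon Y * x F ^+ rho F.
  rewrite -mon_dlt -monD; apply: mon_ext => K; rewrite /gap_mon /dlt.
  have [->|KF] := eqVneq K F; first by rewrite FS YF gapF (negPf FT) subn0 mul1n.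
  by rewrite mul0n addn0 /Y !inE KF.
have monS' : mon (gap_mon S') = mon Y * x G ^+ rho F.
  rewrite -mon_dlt -monD; apply: mon_ext => K; rewrite /gap_mon /dlt.
  have [->|KG] := eqVneq K G.
    rewrite !inE GF GS YG mul1n /= gap'G -gapG -addnBAC //.
    by apply: leq_trans (leq_b1 _) gapG0.
  rewrite mul0n addn0 /Y; case: ifP => // KS'; rewrite gap'K //.
have degY : (deg Y + rho F).+1 = rho setT.
  rewrite -(gap_mon_deg cS TS fS) -(deg_dlt F (rho F)) -degD; congr _.+1.
  apply: deg_ext => K; rewrite /gap_mon /dlt.
  have [->|KF] := eqVneq K F; first by rewrite FS YF gapF (negPf FT) subn0 mul1n.
  by rewrite mul0n addn0 /Y !inE KF.
have sumY (P : pred {set 'I_n}) : (forall L, Y L != 0%N -> P L) -> (\sum_(L | P L) Y L = deg Y)%N.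
  move=> YPP; rewrite /deg big_mkcond; apply: eq_bigr => L _; case: ifP => // PL.
  by apply/esym/eqP; apply: contraFT PL; apply: YPP.
have degY' : (deg Y + r F).+1 = k.
  by move: degY; rewrite /shifted_rank addnA -addSn => /eqP; rewrite eqn_add2r => /eqP.
(* If [K] is below [G], all of [Y] lies above [K]; if [K] is above [G], the factor [x K] adds one to
   the degree of [Y] above [G]. Either degree is large enough for [mon_above_eq0]. Otherwise [K] and
   [G] are incomparable. *)
have xY K : flat K -> F \proper K -> K != G -> x K * mon Y = 0.
  move=> fK FK KG; have nK : nzflat K by apply: nzflatS (fS _ FS) (proper_sub FK).
  pose m L := (dlt K L * 1 + Y L)%N.
  have mE : mon m = x K * mon Y by rewrite /m monD mon_dlt expr1.
  have mf L : m L != 0%N -> nzflat L.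
    by rewrite /m /dlt; have [->//|_] := eqVneq L K; rewrite mul0n add0n => /Ynz.
  have mK : m K != 0%N by rewrite /m /dlt eqxx.
  have sum_m P : (\sum_(L | P L) Y L <= \sum_(L | P L) m L)%N.
    by apply: leq_sum => L _; apply: leq_addl.
  rewrite -mE; have [KsG|KsG] := boolP (K \subset G).
    have KpG : K \proper G by rewrite properEneq KG.
    have KT : K != setT by apply: contraTneq KpG => ->; rewrite properE subsetT andbF.
    apply: (mon_above_eq0 mf KT mK); apply: leq_trans (sum_m _).
    rewrite sumY; last by move=> L /YG' GL; apply: proper_sub_trans GL.
    by rewrite -degY' leq_subLR -addnS addnC leq_add2r mrank_proper.
  have GT : G != setT by apply: contraNneq KsG => ->; apply: subsetT.
  have mG : m G != 0%N.
    by rewrite /m YG (negPf GT) subn0 addn_eq0 negb_and -lt0n orbC -lt0n gapG0.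
  have [GsK|GsK] := boolP (G \subset K); last first.
    by apply: (mon_eq0 mK mG KG); apply: x_incomp => //; rewrite /nonempty_flat fG; have /andP[] := fS _ GS.
  have GpK : G \proper K by rewrite properEneq eq_sym KG.
  apply: (mon_above_eq0 mf GT mG).
  have : (deg Y = Y G + \sum_(L : {set 'I_n} | G \proper L) Y L)%N.
    rewrite -(sumY (fun L => G \subset L)) // (bigD1 G) //=; congr (_ + _)%N.
    by apply: eq_bigl => L; rewrite properEneq eq_sym andbC.
  rewrite /m big_split /= YG (negPf GT) subn0.
  have -> : (\sum_(L : {set 'I_n} | G \proper L) dlt K L * 1 = 1)%N.
    rewrite (bigD1 K) //= big1 ?addn0 /dlt ?eqxx // => L /andP[_ /negPf->]; by rewrite mul0n.
  have aux (a b g f t s q : nat) :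
    (g + (f + t) = s + t -> (b + f).+1 = q -> b = g + a -> q - s <= 1 + a)%N by clear; lia.
  exact: aux gapG degY'.
(* The factors above [F] are [x G] and [Y], of total degree [deg Y + 1 = k - r F]. *)
have xxY : x F * x G * mon Y = 0.
  pose m L := (dlt F L * 1 + (dlt G L * 1 + Y L))%N.
  have <- : mon m = x F * x G * mon Y by rewrite /m monD mon_dlt monD mon_dlt !expr1 mulrA.
  have mF : m F != 0%N by rewrite /m /dlt eqxx.
  apply: mon_above_eq0 FT mF _.
    move=> L; rewrite /m /dlt; have [->|_] := eqVneq L F; first by rewrite fS.
    by have [->|_] := eqVneq L G; [rewrite fS|rewrite !mul0n !add0n => /Ynz].
  rewrite /m !big_split /= sumY; last by move=> L /YG'; apply: proper_sub_trans.
  rewrite [X in (_ <= _ + (X + _))%N](bigD1 G) //= (_ : dlt G G = 1%N); last by rewrite /dlt eqxx.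
  rewrite -degY'.
  have aux (a b g f : nat) : ((b + f).+1 - f <= a + (1 * 1 + g + b))%N by clear; lia.
  exact: aux.
have hY p : h F ^+ p * mon Y = (x F + x G) ^+ p * mon Y.
  elim: p => [|p IHp]; first by rewrite !expr0.
  rewrite !exprS -!mulrA IHp mulrCA [RHS]mulrCA; congr (_ * _).
  rewrite /h (bigD1 F) /= ?subxx ?fF // (bigD1 G) /= ?fG ?(proper_sub FG) // addrA mulrDl.
  rewrite big_distrl [X in _ + X]big1 ?addr0 // => K /andP[/andP[/andP[fK FK] KF] KG].
  by apply: xY; rewrite // properEneq eq_sym KF.
have pY p : (x F + x G) ^+ p.+1 * mon Y = (x F ^+ p.+1 + x G ^+ p.+1) * mon Y.
  elim: p => [|p IHp]; first by rewrite !expr1.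
  rewrite exprS -mulrA IHp mulrA mulrDl !mulrDr -!exprS addrA.
  have xx q : x F * x G ^+ q.+1 * mon Y = 0.
    by rewrite exprS mulrA mulrAC xxY mul0r.
  have xx' q : x G * x F ^+ q.+1 * mon Y = 0.
    by rewrite exprS mulrA [x G * _]mulrC mulrAC xxY mul0r.
  by rewrite !mulrDl xx xx' !addr0.
have [||||b bE] := IH S'.
- by move: Sc; rewrite (cardsD1 F S) FS.
- by apply: chain_sub cS; apply: subsetDl.
- by rewrite !inE eq_sym FT.
- by move=> K /S'P[/fS].
exists (~~ b); rewrite monS; have := pY (rho F).-1; rewrite prednK ?rho_gt0 // -hY upsum_pow //.
rewrite mul0r => /esym/eqP; rewrite mulrDl addr_eq0 mulrC => /eqP ->.
by rewrite mulrC -monS' bE signrN mulNr.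
Qed.

(* Multiplying the relation by the dual monomial of a summand of largest coweight kills all other terms. *)
Lemma mon_indep (I : finType) (w : I -> {set 'I_n} -> nat) (c : I -> A) j :
  (forall i, fy_normal Ind e (w i)) -> (forall i, deg (w i) = j) ->
  (forall i i', w i =1 w i' -> i = i') ->
  (forall i, c i * x setT ^+ (k - e) = 0 -> c i = 0) ->
  \sum_i c i * mon (w i) = 0 -> forall i, c i = 0.
Proof.
move=> wN wj winj ctop sum0 i0; apply/eqP; apply: contraT => ci0.
case: (@arg_maxnP _ i0 (fun i => c i != 0) (fun i => coweight (w i)) ci0) => i ci imax.
have /negP[] := ci; apply/eqP/ctop.
have := congr1 ( *%R^~ (mon (dual (w i)))) sum0; rewrite mul0r big_distrl (bigD1 i) //=.
rewrite [X in _ + X]big1 ?addr0 => [|i' ii'].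
  rewrite -mulrA -monD (mon_ext _ (fun K => add_dual K (wN i))).
  have [b ->] := @gap_mon_top (setT |: supp (w i)) (supp_setT_chain (wN i)) (setU11 _ _) (supp_setT_nzflat (wN i)).
  have -> : ((rho setT).-1 = k - e)%N by rewrite /shifted_rank; have -> : r setT = k by []; lia.
  by rewrite mulrCA => /(congr1 ( *%R ((-1) ^+ b))); rewrite mulr0 signrMK.
have [->|ci'] := eqVneq (c i') 0; first by rewrite !mul0r.
rewrite -mulrA -monD; apply/eqP; apply: contraT => nz'.
have nz : mon (fun K => w i' K + dual (w i) K)%N != 0.
  by apply: contra nz' => /eqP ->; rewrite mulr0.
have vw : deg (w i') = deg (w i) by rewrite !wj.
have /winj E := coweight_eq (wN i) (wN i') vw nz (imax _ ci').
by rewrite E eqxx in ii'.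
Qed.
End ChowRelations.

(** * The degree functional *)

(** Moebius inversion from the top: once [x] is known on all larger sets, the equation for [F]
    determines [x F]. The induction on [s] goes down by size. *)
Lemma upper_inversion (T : finType) (V : zmodType) (P : pred {set T}) (g : {set T} -> V) :
  exists x : {set T} -> V, forall F, P F -> (\sum_(K | P K && (F \subset K)) x K = g F)%R.
Proof.
suff H s : exists x : {set T} -> V, forall F, P F -> #|T| - #|F| < s ->
    (\sum_(K | P K && (F \subset K)) x K = g F)%R.
  by have [x xP] := H #|T|.+1; exists x => F PF; apply: xP; rewrite ?ltnS ?leq_subr.
elim: s => [|s [x xP]]; first by exists (fun=> 0%R).
pose y (F : {set T}) : V := if #|T| - #|F| == s then (g F - \sum_(K | P K && (F \proper K)) x K)%R else x F.
exists y => F PF; have lt (K : {set T}) : F \proper K -> #|T| - #|K| < #|T| - #|F|.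
  by move=> /proper_card FK; rewrite ltn_sub2l // (leq_trans FK) ?max_card.
rewrite ltnS leq_eqVlt => /orP[Fs|Fs].
  rewrite (bigD1 F) ?PF ?subxx //= {1}/y Fs.
  have -> : (\sum_(K | P K && (F \subset K) && (K != F)) y K = \sum_(K | P K && (F \proper K)) x K)%R.
    apply: eq_big => [K|K /andP[/andP[_ FK] KF]]; first by rewrite -andbA properEneq andbC [F == K]eq_sym andbC [_ && (_ \subset _)]andbC.
    rewrite /y ifF //; apply: ltn_eqF; rewrite -(eqP Fs) lt //.
    by rewrite properEneq eq_sym KF.
  by rewrite subrK.
rewrite -(xP _ PF Fs); apply: eq_bigr => K /andP[_ FK]; rewrite /y ifF //.
by apply: ltn_eqF; apply: leq_ltn_trans Fs; rewrite leq_sub2l ?subset_leq_card.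
Qed.

Section Functional.
Variables (n : nat) (Ind : {set {set 'I_n}}) (e : nat).
Hypotheses (HM : is_matroid Ind) (HL : loopless Ind) (e1 : e <= 1).
Local Notation r := (mrank Ind).
Local Notation flat := (is_flat Ind).
Local Notation k := (matroid_rank Ind).
Local Notation cl := (mclosure Ind).
Local Notation N := #|{set 'I_n}|.
Local Notation H := {mpoly rat[#|{set 'I_n}|]}.
Implicit Types (F G K L T : {set 'I_n}) (m : 'X_{1..N}) (p q : H).
Local Open Scope ring_scope.

(** The variable of index [enum_rank T] stands for $h_T$; all subsets, not only flats, index
    variables. *)
Definition mult m L : nat := (\sum_(T : {set 'I_n} | T \subset L) m (enum_rank T))%N.

Lemma multD m1 m2 L : mult (m1 + m2)%MM L = (mult m1 L + mult m2 L)%N.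
Proof. by rewrite /mult -big_split; apply: eq_bigr => T _; rewrite mnmDE. Qed.

Lemma multU T L : mult U_(enum_rank T)%MM L = (T \subset L).
Proof.
rewrite /mult; case TL: (T \subset L).
  rewrite (bigD1 T) //= mnm1E eqxx big1 // => K /andP[_ KT].
  by rewrite mnm1E (inj_eq enum_rank_inj) eq_sym (negPf KT).
rewrite big1 // => K KL; rewrite mnm1E (inj_eq enum_rank_inj).
by case: eqP => // E; rewrite E KL in TL.
Qed.

Lemma mult_setT m : mult m setT = mdeg m.
Proof.
rewrite mdegE (reindex (@enum_rank {set 'I_n})) /=; last exact/onW_bij/enum_rank_bij.
by apply: eq_bigl => T; rewrite subsetT.
Qed.

Lemma mult_supermod m L L' (V : {set 'I_n}) : L \subset V -> L' \subset V ->
  (mult m L + mult m L' <= mult m V + mult m (L :&: L'))%N.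
Proof.
move=> LV LV'; rewrite /mult !(big_mkcond (fun T : {set 'I_n} => T \subset _)) -!big_split /=.
apply: leq_sum => T _; rewrite subsetI.
case TL: (T \subset L); first by rewrite (subset_trans TL LV) /=; case: (T \subset L') => //.
by case TL': (T \subset L'); rewrite //= (subset_trans TL' LV') addnC.
Qed.

(* The dragon Hall-Rado condition: the values of the degree map on monomials in the classes [h_T]. *)
Definition hall_rado m : bool :=
  [forall L, flat L ==> ((mult m L == 0%N) || (mult m L + e <= r L)%N)].

(** Monomials of every degree contribute, not only those of top degree. The cutoff loses nothing:
    beyond degree [k] the condition fails at [setT]. *)
Definition degree p : rat := \sum_(m : 'X_{1..N < k.+1}) p@_m * (hall_rado m)%:R.

Lemma degreeX m : degree 'X_[m] = (hall_rado m)%:R.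
Proof.
have [lt|ge] := ltnP (mdeg m) k.+1.
  rewrite /degree (bigD1 (BMultinom lt)) //= mcoeffX eqxx mul1r big1 ?addr0 // => m' m'm.
  rewrite mcoeffX; case: eqP => [E|]; rewrite ?mul0r //.
  by move: m'm; rewrite -val_eqE /= E eqxx.
rewrite /degree big1 => [|m' _]; last first.
  rewrite mcoeffX; case: eqP => [E|]; rewrite ?mul0r //.
  by have := bmdeg m'; rewrite -E ltnNge ge.
case: (boolP (hall_rado m)) => // /forallP/(_ setT); rewrite flatT mult_setT /=.
by have -> : r setT = k by []; case/orP=> [/eqP m0|]; move: ge; rewrite ?m0 //; lia.
Qed.

Lemma degree_sum I (s : seq I) (P : pred I) (f : I -> H) :
  degree (\sum_(i <- s | P i) f i) = \sum_(i <- s | P i) degree (f i).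
Proof.
rewrite /degree exchange_big /=; apply: eq_bigr => m _.
by rewrite raddf_sum /= big_distrl.
Qed.

Lemma degreeD p q : degree (p + q) = degree p + degree q.
Proof. by rewrite /degree -big_split; apply: eq_bigr => m _; rewrite mcoeffD mulrDl. Qed.

Lemma degreeZ c p : degree (c *: p) = c * degree p.
Proof. by rewrite /degree big_distrr; apply: eq_bigr => m _; rewrite mcoeffZ -mulrA. Qed.

(** The largest ideal inside the kernel of [degree]; the images of the Chow relations are shown to
    lie in it. *)
Definition ann p := forall q, degree (p * q) = 0.

Lemma annX p : (forall m, degree (p * 'X_[m]) = 0) -> ann p.
Proof.
move=> h q; rewrite [q]mpolyE big_distrr degree_sum big1 // => m _ /=.
by rewrite -scalerAr degreeZ h mulr0.
Qed.

Lemma annD p q : ann p -> ann q -> ann (p + q).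
Proof. by move=> hp hq s; rewrite mulrDl degreeD hp hq addr0. Qed.
Lemma annMl p q : ann p -> ann (q * p).
Proof. by move=> hp s; rewrite mulrAC mulrC; apply: hp. Qed.
Lemma annMr p q : ann p -> ann (p * q).
Proof. by rewrite mulrC; apply: annMl. Qed.
Lemma annN p : ann p -> ann (- p).
Proof. by rewrite -mulN1r; apply: annMl. Qed.
Lemma annB p q : ann p -> ann q -> ann (p - q).
Proof. by move=> hp hq; apply: annD => //; apply: annN. Qed.
Lemma ann0 : ann 0.
Proof. by move=> q; rewrite mul0r /degree big1 // => m _; rewrite mcoeff0 mul0r. Qed.
Lemma ann_sum I (s : seq I) (P : pred I) (f : I -> H) :
  (forall i, P i -> ann (f i)) -> ann (\sum_(i <- s | P i) f i).
Proof. by move=> h; apply: big_ind => //; [apply: ann0|apply: annD]. Qed.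

Definition hv T : H := 'X_(enum_rank T).

Lemma hall_radoP m T T' : reflect
  (forall L, flat L -> let t := (mult m L + (T \subset L) + (T' \subset L))%N in
     t = 0%N \/ (t + e <= r L)%N)
  (hall_rado (U_(enum_rank T) + U_(enum_rank T') + m)%MM).
Proof.
have E L : mult (U_(enum_rank T) + U_(enum_rank T') + m)%MM L =
    (mult m L + (T \subset L) + (T' \subset L))%N by rewrite !multD !multU addnC addnA.
apply: (iffP forallP) => h L; last by apply/implyP => /h /=; rewrite E => -[->|->]; rewrite ?orbT.
by move=> fL; have /implyP/(_ fL) := h L; rewrite E => /orP[/eqP|]; [left|right].
Qed.

Lemma hall_rado_mono m (A A' B B' : {set 'I_n}) :
  (forall L, flat L -> ((A' \subset L) <= (A \subset L))%N) ->
  (forall L, flat L -> ((B' \subset L) <= (B \subset L))%N) ->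
  hall_rado (U_(enum_rank A) + U_(enum_rank B) + m)%MM ->
  hall_rado (U_(enum_rank A') + U_(enum_rank B') + m)%MM.
Proof.
have aux (c a a' b b' s : nat) : (a' <= a)%N -> (b' <= b)%N ->
  (c + a + b = 0 \/ c + a + b + e <= s)%N -> (c + a' + b' = 0 \/ c + a' + b' + e <= s)%N by clear; lia.
move=> AA BB /hall_radoP h; apply/hall_radoP => L fL.
exact: aux (AA L fL) (BB L fL) (h L fL).
Qed.

Lemma degree_hv2 T T' m :
  degree (hv T * hv T' * 'X_[m]) = (hall_rado (U_(enum_rank T) + U_(enum_rank T') + m)%MM)%:R.
Proof. by rewrite -!mpolyXD degreeX. Qed.

(** These are the four terms of $(h_F-h_J)(h_G-h_J)$. Enlarging [F] or [G] to [J] weakens the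
    condition, and [b] with [c] gives [a] since a flat containing [F] and [G] contains [J]. The real
    content is that [d] implies [b] or [c]. *)
Lemma hall_rado_exchange m F G (J := cl (F :|: G)) :
  let a := hall_rado (U_(enum_rank F) + U_(enum_rank G) + m)%MM in
  let b := hall_rado (U_(enum_rank F) + U_(enum_rank J) + m)%MM in
  let c := hall_rado (U_(enum_rank J) + U_(enum_rank G) + m)%MM in
  let d := hall_rado (U_(enum_rank J) + U_(enum_rank J) + m)%MM in
  (a + d = b + c)%N.
Proof.
have JE L : flat L -> (J \subset L) = (F \subset L) && (G \subset L).
  by move=> fL; rewrite /J sub_clE // subUset.
have JF L : flat L -> ((J \subset L) <= (F \subset L))%N by move/JE ->; case: (F \subset L); case: (G \subset L).
have JG L : flat L -> ((J \subset L) <= (G \subset L))%N by move/JE ->; case: (F \subset L); case: (G \subset L).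
have id T L : flat L -> ((T \subset L) <= (T \subset L))%N by [].
move=> a b c d.
have ab : a -> b by apply: hall_rado_mono; [apply: id|apply: JG].
have ac : a -> c by apply: hall_rado_mono; [apply: JF|apply: id].
have bd : b -> d by apply: hall_rado_mono; [apply: JF|apply: id].
have cd : c -> d by apply: hall_rado_mono; [apply: id|apply: JG].
have bca : b -> c -> a.
  move=> /hall_radoP hb /hall_radoP hc; apply/hall_radoP => L fL.
  have := hb L fL; have := hc L fL; rewrite /= JE //.
  by case: (F \subset L); case: (G \subset L).
have aux1 (f g : bool) (t s : nat) : (f + (f && g) + t != 0)%N -> ~~ (f + (f && g) + t + e <= s)%N ->
    (t + (f && g) + (f && g) = 0 \/ t + (f && g) + (f && g) + e <= s)%N ->
    [/\ f, ~~ g & (s < t + 1 + e)%N].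
  by clear; case: f; case: g => /= h1 h2 h3; split=> //; lia.
have aux2 (f g : bool) (t s : nat) : ((f && g) + g + t != 0)%N -> ~~ ((f && g) + g + t + e <= s)%N ->
    (t + (f && g) + (f && g) = 0 \/ t + (f && g) + (f && g) + e <= s)%N ->
    [/\ ~~ f, g & (s < t + 1 + e)%N].
  by clear; case: f; case: g => /= h1 h2 h3; split=> //; lia.
(* Indices 1 to 4 stand for [L], [L'], their join and their meet. If no factor lies in the meet, the
   other inequalities would force [2 <= e]. *)
have aux3 (a1 a2 a3 a4 r1 r2 r3 r4 : nat) : (r1 < a1 + 1 + e)%N -> (r2 < a2 + 1 + e)%N ->
    (a4 + 0 + 0 = 0 \/ a4 + 0 + 0 + e <= r4)%N -> (a3 + 1 + 1 = 0 \/ a3 + 1 + 1 + e <= r3)%N ->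
    (r3 + r4 <= r1 + r2)%N -> (a1 + a2 <= a3 + a4)%N -> False by move: e1; clear; lia.
(* Given [d], a flat [L] violating [b] contains [F] but not [G], and a flat [L'] violating [c] the
   reverse. Their join contains [J] and their meet neither, so submodularity of the rank against
   [mult_supermod] gives a contradiction. *)
have dbc : d -> b || c.
  move=> /hall_radoP hd; apply: contraT; rewrite negb_or => /andP[/forallPn[L Lb] /forallPn[L' Lc]].
  move: Lb Lc; rewrite !negb_imply => /andP[fL Lb] /andP[fL' Lc].
  have [FL GL hL] : [/\ F \subset L, ~~ (G \subset L) & (r L < mult m L + 1 + e)%N].
    by move: (hd _ fL); case/norP: Lb; rewrite !multD !multU JE //; apply: aux1.
  have [FL' GL' hL'] : [/\ ~~ (F \subset L'), G \subset L' & (r L' < mult m L' + 1 + e)%N].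
    by move: (hd _ fL'); case/norP: Lc; rewrite !multD !multU JE //; apply: aux2.
  have V1 : L \subset cl (L :|: L') by apply: subset_trans (sub_cl _ _); apply: subsetUl.
  have V2 : L' \subset cl (L :|: L') by apply: subset_trans (sub_cl _ _); apply: subsetUr.
  have := mult_supermod m V1 V2; have := mrank_submod HM L L'.
  have := hd _ (flat_cl HM (L :|: L')); have := hd _ (flatI HM fL fL').
  rewrite /= !JE ?flat_cl ?flatI // mrank_cl // !subsetI (negPf FL') (negPf GL) !andbF /=.
  rewrite (subset_trans FL V1) (subset_trans GL' V2) /=.
  by move=> h4 h3 hs hm; case: (aux3 _ _ _ _ _ _ _ _ hL hL' h4 h3 hs hm).
move: {JE JF JG id aux1 aux2 aux3}a b c d ab ac bd cd bca dbc => a b c d.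
by case: a; case: b; case: c; case: d => //= ab ac bd cd bca dbc;
  first [by have := ab isT|by have := ac isT|by have := bd isT|by have := cd isT|by have := bca isT isT|by have := dbc isT].
Qed.

Lemma ann_join F G (J := cl (F :|: G)) : ann ((hv F - hv J) * (hv G - hv J)).
Proof.
apply: annX => m.
have -> : (hv F - hv J) * (hv G - hv J) * 'X_[m] =
    hv F * hv G * 'X_[m] + hv J * hv J * 'X_[m] - (hv F * hv J * 'X_[m] + hv J * hv G * 'X_[m]).
  by ring.
rewrite -scaleN1r !degreeD degreeZ !degreeD !degree_hv2 mulN1r -!natrD.
by rewrite hall_rado_exchange subrr.
Qed.

(** The two conditions differ only at flats [L] containing [F] but not [a]. There the condition at
    [cl (a |: L)], where both factors count and the rank is at most one more, implies the one at
    [L]. *)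
Lemma ann_atom_join a F : flat F -> a \notin F ->
  ann (hv (cl [set a]) * (hv F - hv (cl (a |: F)))).
Proof.
move=> fF aF; apply: annX => m; set J := cl (a |: F).
have aE L : flat L -> (cl [set a] \subset L) = (a \in L) by move=> fL; rewrite sub_clE // sub1set.
have JE L : flat L -> (J \subset L) = (a \in L) && (F \subset L).
  by move=> fL; rewrite /J sub_clE // subUset sub1set.
have -> : hv (cl [set a]) * (hv F - hv J) * 'X_[m] =
    hv (cl [set a]) * hv F * 'X_[m] + (-1) *: (hv (cl [set a]) * hv J * 'X_[m]).
  by rewrite scaleN1r; ring.
rewrite degreeD degreeZ !degree_hv2 mulN1r.
suff -> : hall_rado (U_(enum_rank (cl [set a])) + U_(enum_rank F) + m)%MM =
  hall_rado (U_(enum_rank (cl [set a])) + U_(enum_rank J) + m)%MM by rewrite subrr.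
apply/idP/idP => [|/hall_radoP h].
  apply: hall_rado_mono => // L fL; rewrite JE //.
  by case: (a \in L); case: (F \subset L).
apply/hall_radoP => L fL; have := h L fL; rewrite /= aE // JE //.
have [//|aL] := boolP (a \in L); have [FL _|//] := boolP (F \subset L).
have LV : L \subset cl (a |: L) by apply: subset_trans (sub_cl _ _); apply: subsetUr.
have := h _ (flat_cl HM (a |: L)); rewrite /= aE ?flat_cl // JE ?flat_cl // (subset_trans FL LV).
rewrite (subsetP (sub_cl _ _)) ?setU11 //= mrank_cl //.
have := mult_supermod m LV LV; rewrite setIid leq_add2r.
have aux (t s t' s' : nat) : (t <= t')%N -> (s' <= s.+1)%N -> (t' + 1 + 1 = 0 \/ t' + 1 + 1 + e <= s')%N ->
  (t + 0 + 1 = 0 \/ t + 0 + 1 + e <= s)%N by clear; lia.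
by move=> tt; apply: aux tt _; apply: mrankU1.
Qed.

Lemma ann_set0 : ann (hv set0).
Proof.
apply: annX => m; rewrite /hv -mpolyXD degreeX.
suff /negPf -> : ~~ hall_rado (U_(enum_rank set0) + m)%MM by [].
apply/forallPn; exists set0; rewrite negb_imply flat0 //= negb_or multD multU sub0set mrank0 //.
Qed.

Lemma ann_atom a : e = 1%N -> ann (hv (cl [set a])).
Proof.
move=> e_1; apply: annX => m; rewrite /hv -mpolyXD degreeX.
suff /negPf -> : ~~ hall_rado (U_(enum_rank (cl [set a])) + m)%MM by [].
apply/forallPn; exists (cl [set a]); rewrite negb_imply flat_cl //= negb_or multD multU subxx.
by rewrite mrank_cl // mrank1 // e_1 addn1 ltnS -leqn0.
Qed.

Lemma degree_top : (e <= k)%N -> degree (hv setT ^+ (k - e)) = 1.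
Proof.
move=> ek; rewrite /hv mpolyXn degreeX.
suff -> : hall_rado (U_(enum_rank setT) *+ (k - e))%MM by [].
have multE c L : mult (U_(enum_rank setT) *+ c)%MM L = (c * (setT \subset L))%N.
  elim: c => [|c IH]; first by rewrite mulm0n /mult big1 // => T _; rewrite mnm0E.
  by rewrite mulmS multD IH multU mulSn.
apply/forallP => L; apply/implyP => _; rewrite multE subTset.
have [->|_] := eqVneq L setT; last by rewrite muln0.
by rewrite muln1 subnK // leqnn orbT.
Qed.

(** * The classes of single flats, expressed through the $h_T$ *)

Section Inversion.
Variable xh : {set 'I_n} -> H.
Hypothesis xhE : forall F, flat F -> \sum_(K | flat K && (F \subset K)) xh K = hv F.

Lemma hv_sub F J : flat F -> flat J -> F \subset J ->
  hv F - hv J = \sum_(K | [&& flat K, F \subset K & ~~ (J \subset K)]) xh K.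
Proof.
move=> fF fJ FJ; rewrite -!xhE // (bigID (fun K : {set 'I_n} => J \subset K)) /= addrAC.
rewrite (eq_bigl (fun K => flat K && (J \subset K))) ?subrr ?add0r => [|K].
  by apply: eq_bigl => K; rewrite -andbA.
rewrite -andbA; case: (flat K) => //=; apply/andP/idP => [[]//|JK]; split=> //.
exact: subset_trans JK.
Qed.

(** Expanding [ann_join] gives products [xh K * xh L] with [F] inside [K] but not [L], and [G]
    inside [L] but not [K]. All these pairs are incomparable and all except [(F, G)] are larger, so
    descending induction removes them. *)
Lemma ann_incomp F G : flat F -> flat G -> ~~ (F \subset G) -> ~~ (G \subset F) -> ann (xh F * xh G).
Proof.
have [c] := ubnP ((n - #|F|) + (n - #|G|)); elim: c F G => // c IH F G lt fF fG FG GF.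
pose J := cl (F :|: G); have fJ : flat J by apply: flat_cl.
have FJ : F \subset J by apply: subset_trans (sub_cl _ _); apply: subsetUl.
have GJ : G \subset J by apply: subset_trans (sub_cl _ _); apply: subsetUr.
have JE K : flat K -> (J \subset K) = (F \subset K) && (G \subset K).
  by move=> fK; rewrite /J sub_clE // subUset.
have : ann ((hv F - hv J) * (hv G - hv J)) := ann_join F G.
rewrite (hv_sub fF fJ FJ) (hv_sub fG fJ GJ) big_distrlr /=.
rewrite (bigD1 F) /= ?fF ?subxx ?JE ?subxx // (bigD1 G) /= ?fG ?subxx ?JE ?subxx ?andbT //.
set s1 := \sum_(K | _) _; set s2 := \sum_(K | _) _ => hann.
have an K L : flat K -> flat L -> F \subset K -> G \subset L -> ~~ (G \subset K) -> ~~ (F \subset L) ->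
    (K != F) || (L != G) -> ann (xh K * xh L).
  move=> fK fL FK GL GK FL KL; apply: IH => //.
  - have cK (K' : {set 'I_n}) : (#|K'| <= n)%N by rewrite -[leqRHS]card_ord max_card.
    have aux (f g k1 l : nat) : (n - f + (n - g) < c.+1)%N -> (k1 <= n)%N -> (l <= n)%N ->
      (f <= k1)%N -> (g <= l)%N -> (f < k1)%N || (g < l)%N -> (n - k1 + (n - l) < c)%N by clear; lia.
    apply: aux lt _ _ (subset_leq_card FK) (subset_leq_card GL) _; rewrite ?cK //.
    by case/orP: KL => [KF|LG]; apply/orP; [left|right]; rewrite proper_card // properEneq eq_sym ?KF ?LG.
  - by apply: contra FL; apply: subset_trans.
  - by apply: contra GK; apply: subset_trans.
have -> : xh F * xh G = (xh F * xh G + s1 + s2) - s2 - s1 by ring.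
apply: annB; first apply: annB => //; apply: ann_sum.
- move=> K /andP[/and3P[fK FK]]; rewrite JE // FK /= => GK KF.
  apply: ann_sum => L /and3P[fL GL]; rewrite JE // GL andbT => FL.
  by apply: an; rewrite ?KF.
- move=> L /andP[/and3P[fL GL]]; rewrite JE // GL andbT => FL LG.
  by apply: an; rewrite ?LG ?orbT.
Qed.

Lemma ann_atom_x a F : flat F -> a \notin F -> ann (hv (cl [set a]) * xh F).
Proof.
have [c] := ubnP (n - #|F|); elim: c F => // c IH F lt fF aF.
have := ann_atom_join fF aF; rewrite hv_sub ?flat_cl //; last first.
  by apply: subset_trans (sub_cl _ _); apply: subsetUr.
rewrite (bigD1 F) /= ?fF ?subxx //; last first.
  by apply: contra aF => /subsetP; apply; rewrite (subsetP (sub_cl _ _)) ?setU11.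
rewrite mulrDr; set s := \sum_(K | _) _ => hann.
rewrite -[hv _ * _](addrK (hv (cl [set a]) * s)); apply: annB => //.
rewrite big_distrr; apply: ann_sum => K /andP[/and3P[fK FK JK] KF] /=.
apply: IH => //; last first.
  by apply: contra JK => aK; rewrite sub_clE // subUset sub1set aK.
have FpK : F \proper K by rewrite properEneq eq_sym KF.
have hK : (#|K| <= n)%N by rewrite -[leqRHS]card_ord max_card.
have aux (f k1 : nat) : (n - f < c.+1)%N -> (k1 <= n)%N -> (f < k1)%N -> (n - k1 < c)%N by clear; lia.
exact: aux lt hK (proper_card FpK).
Qed.
End Inversion.
End Functional.

(** * Quotients by ideals and Hilbert coefficients *)

Local Open Scope ring_scope.

Section IdealQuotient.
Variables (N : nat) (gs : seq {mpoly rat[N]}).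
Implicit Types p q : {mpoly rat[N]}.

Lemma in_idealP p : in_ideal gs p <->
  exists c : nat -> {mpoly rat[N]}, p = \sum_(i < size gs) c i * gs`_i.
Proof.
split=> [[cs ->]|[c ->]]; first by exists (nth 0 cs).
by exists (mkseq c (size gs)); apply: eq_bigr => i _; rewrite nth_mkseq.
Qed.

Lemma in_ideal_comb a p q : in_ideal gs p -> in_ideal gs q -> in_ideal gs (a * p + q).
Proof.
move=> /in_idealP[c ->] /in_idealP[d ->]; apply/in_idealP; exists (fun i => a * c i + d i).
by rewrite big_distrr -big_split; apply: eq_bigr => i _; rewrite /= mulrDl mulrA.
Qed.

Lemma in_ideal0 : in_ideal gs 0.
Proof. by apply/in_idealP; exists (fun=> 0); rewrite big1 // => i _; rewrite mul0r. Qed.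

Lemma in_ideal_gen g : g \in gs -> in_ideal gs g.
Proof.
move=> /(nthP 0)[i ilt <-]; apply/in_idealP; exists (fun j => (j == i)%:R).
rewrite (bigD1 (Ordinal ilt)) //= eqxx mul1r big1 ?addr0 // => j ji.
by rewrite (_ : (j == i :> nat) = false) ?mul0r //; apply: contraNF ji => /eqP E; apply/eqP/val_inj.
Qed.

Hypothesis gs0 : forall g, g \in gs -> g@_0%MM = 0.

Definition ideal_pred : pred {mpoly rat[N]} :=
  fun p => if excluded_middle_informative (in_ideal gs p) then true else false.

Lemma ideal_predP p : reflect (in_ideal gs p) (p \in ideal_pred).
Proof.
by rewrite unfold_in /ideal_pred; case: excluded_middle_informative => h; constructor.
Qed.

Lemma ideal_pred_closed : idealr_closed ideal_pred.
Proof.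
split; first by apply/ideal_predP; exact: in_ideal0.
  (* All generators have constant term zero, so 1 is not in the ideal and the quotient is a
     nontrivial ring. *)
  apply/negP => /ideal_predP/in_idealP[c /(congr1 (mcoeff 0%MM))].
  rewrite mcoeff1 eqxx raddf_sum big1 /= => [/eqP|i _]; first by rewrite oner_eq0.
  have h : forall p q : {mpoly rat[N]}, q@_0%MM = 0 -> (p * q)@_0%MM = 0.
    by move=> p q q0; rewrite (rmorphM (mcoeff 0%MM)) /= q0 mulr0.
  by apply: h; apply: gs0; apply: mem_nth.
move=> a u v /ideal_predP hu /ideal_predP hv; apply/ideal_predP; exact: in_ideal_comb.
Qed.

HB.instance Definition _ := isIdealr.Build {mpoly rat[N]} ideal_pred ideal_pred_closed.

Lemma ideal_quotient_ex : exists (A : comNzRingType) (f : {rmorphism {mpoly rat[N]} -> A}),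
  forall p, f p = 0 <-> in_ideal gs p.
Proof.
pose I : idealr {mpoly rat[N]} := ideal_pred; pose A : comNzRingType := {ideal_quot I}.
exists A, \pi_A%qT => p.
split=> [h|/ideal_predP h].
  apply/ideal_predP; have := Quotient.idealrBE I p 0; rewrite subr0 => ->; apply/eqP.
  by rewrite [LHS]h; apply/esym/(rmorph0 (\pi_A%qT : {rmorphism {mpoly rat[N]} -> A})).
have := Quotient.idealrBE I p 0; rewrite subr0 => E; rewrite E in h; rewrite [LHS](eqP h).
exact: (rmorph0 (\pi_A%qT : {rmorphism {mpoly rat[N]} -> A})).
Qed.
End IdealQuotient.

Lemma lin_dep d (W : finType) (C : 'I_d -> W -> rat) : (#|W| < d)%N ->
  exists c : 'I_d -> rat, (exists i, c i != 0) /\ forall w, \sum_i c i * C i w = 0.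
Proof.
move=> Wd; pose M := \matrix_(i < d, j < #|W|) C i (enum_val j).
have : kermx M != 0.
  rewrite -mxrank_eq0 mxrank_ker -lt0n subn_gt0.
  by apply: leq_ltn_trans (rank_leq_col M) Wd.
case/rowV0Pn=> v /sub_kermxP vM v0; exists (v 0); split.
  have /rV0Pn[i vi] := v0; by exists i.
move=> w; have := congr1 (fun B : 'rV_ _ => B 0 (enum_rank w)) vM; rewrite !mxE => E.
by rewrite -[RHS]E; apply: eq_bigr => i _; rewrite mxE enum_rankK.
Qed.

(** * Bounds on Hilbert coefficients from spanning and independent families *)

Section HilbertCoefficients.
Variables (N : nat) (gs : seq {mpoly rat[N]}) (j : nat).
Implicit Types p q : {mpoly rat[N]}.

Lemma in_idealZ c p : in_ideal gs p -> in_ideal gs (c *: p).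
Proof. by rewrite -mul_mpolyC -[_ * p]addr0 => h; apply: in_ideal_comb (in_ideal0 gs). Qed.

Lemma in_ideal_sum I (s : seq I) (P : pred I) (f : I -> {mpoly rat[N]}) :
  (forall i, P i -> in_ideal gs (f i)) -> in_ideal gs (\sum_(i <- s | P i) f i).
Proof.
move=> h; apply: big_ind => //; first exact: in_ideal0.
by move=> p q hp hq; rewrite -[p]mul1r; apply: in_ideal_comb.
Qed.

Lemma spanned_dep d (ps : 'I_d -> {mpoly rat[N]}) (W : finType) (mu : W -> {mpoly rat[N]}) :
  (forall i, exists c : W -> rat, in_ideal gs (ps i - \sum_w c w *: mu w)) -> (#|W| < d)%N ->
  exists c : 'I_d -> rat, (exists i, c i != 0) /\ in_ideal gs (\sum_i c i *: ps i).
Proof.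
move=> /(fin_all_exists (U := fun=> W -> rat))[C hC] /(lin_dep C)[c [c0 hc]].
exists c; split=> //.
suff -> : \sum_i c i *: ps i = \sum_i c i *: (ps i - \sum_w C i w *: mu w).
  by apply: in_ideal_sum => i _; apply: in_idealZ.
have -> : \sum_i c i *: (ps i - \sum_w C i w *: mu w) =
    \sum_i c i *: ps i - \sum_w (\sum_i c i * C i w) *: mu w.
  under eq_bigr do rewrite scalerBr.
  rewrite big_split /= sumrN; congr (_ - _).
  under [RHS]eq_bigr do rewrite scaler_suml.
  rewrite exchange_big; apply: eq_bigr => i _ /=; rewrite scaler_sumr.
  by apply: eq_bigr => w _; rewrite scalerA.
by rewrite [X in _ - X]big1 ?subr0 // => w _; rewrite hc scale0r.
Qed.

Lemma hilb_coeff_le (W : finType) (mu : W -> {mpoly rat[N]}) :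
  (forall p, p \is j.-homog -> exists c : W -> rat, in_ideal gs (p - \sum_w c w *: mu w)) ->
  (hilb_coeff gs j <= #|W|)%N.
Proof.
move=> span; apply/bigmax_leqP => d; case: excluded_middle_informative => // -[ps [sz [/allP hom ind]]] _.
rewrite /= -[leqLHS]sz leqNgt; apply/negP => lt.
have [i|c [[i ci] hc]] := @spanned_dep (size ps) (fun i => ps`_i) W mu _ lt.
  by apply/span/hom/mem_nth.
by move: ci; rewrite (ind c hc) eqxx.
Qed.

(** [hilb_coeff] searches only up to [j.+1 ^ N], so a lower bound on it needs independent families
    to respect this limit. Exponents in degree [j] are at most [j], which leaves that many exponent
    vectors. *)
Lemma homog_indep_card (W : finType) (mu : W -> {mpoly rat[N]}) : (forall w, mu w \is j.-homog) ->
  (forall c : W -> rat, in_ideal gs (\sum_w c w *: mu w) -> forall w, c w = 0) ->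
  (#|W| <= j.+1 ^ N)%N.
Proof.
move=> hom ind; rewrite leqNgt; apply/negP => lt.
pose W' := {ffun 'I_N -> 'I_j.+1}.
pose mu' (f : W') : {mpoly rat[N]} := 'X_[[multinom (f i : nat) | i < N]].
have [i||c [[i ci] hc]] := @spanned_dep #|W| (fun i => mu (enum_val i)) W' mu'.
- set p := mu _; have /dhomogP ph := hom (enum_val i).
  pose g (m : 'X_{1..N}) : W' := [ffun i => inord (m i)].
  exists (fun f : W' => p@_[multinom (f i : nat) | i < N]); rewrite {1}[p]mpolyE.
  have gK m : m \in msupp p -> [multinom (g m i : nat) | i < N] = m.
    move=> /ph md; apply/mnmP => l; rewrite mnmE ffunE inordK // ltnS.
    by rewrite -md /= mdegE (bigD1 l) //= leq_addr.
  have -> : \sum_(m <- msupp p) p@_m *: 'X_[m] = \sum_(f : W') p@_[multinom (f i : nat) | i < N] *: mu' f.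
    rewrite [RHS](bigID (fun f : W' => [multinom (f i : nat) | i < N] \in msupp p)) /=.
    rewrite [X in _ + X]big1 ?addr0 => [|f /memN_msupp_eq0->]; last by rewrite scale0r.
    rewrite [RHS](eq_bigl (fun f => f \in [seq g m | m <- msupp p])).
      have ginj : {in msupp p &, injective g}.
        by move=> m m' mp mp' E; rewrite -(gK m mp) -(gK m' mp') E.
      have su : uniq [seq g m | m <- msupp p] by rewrite (map_inj_in_uniq ginj) msupp_uniq.
      rewrite -[RHS]big_uniq //.
      rewrite [RHS]big_map big_seq [RHS]big_seq.
      by apply: eq_bigr => m mp; rewrite /mu' gK.
    move=> f; apply/idP/mapP => [fp|[m mp ->]]; last by rewrite gK.
    exists [multinom (f i : nat) | i < N] => //; apply/ffunP => l.
    by rewrite ffunE mnmE inord_val.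
  by rewrite subrr; apply: in_ideal0.
- by rewrite card_ffun !card_ord.
have := ind (fun w => c (enum_rank w)); rewrite (reindex (@enum_val W W)) /=; last exact/onW_bij/enum_val_bij.
under eq_bigr do rewrite enum_valK.
by move=> /(_ hc (enum_val i)); rewrite enum_valK => E; rewrite E eqxx in ci.
Qed.

Lemma hilb_coeff_ge (W : finType) (mu : W -> {mpoly rat[N]}) : (forall w, mu w \is j.-homog) ->
  (forall c : W -> rat, in_ideal gs (\sum_w c w *: mu w) -> forall w, c w = 0) ->
  (#|W| <= hilb_coeff gs j)%N.
Proof.
move=> hom ind; have le := homog_indep_card hom ind; rewrite -ltnS in le.
have -> : #|W| = val (Ordinal le) by [].
apply: (@leq_bigmax_cond _ _ (fun d : 'I_(j.+1 ^ N).+1 => val d)).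
case: excluded_middle_informative => // -[]; pose ps := [seq mu w | w <- enum W].
have sz : size ps = #|W| by rewrite size_map -cardE.
exists ps; split=> //; split; first by apply/allP => p /mapP[w _ ->].
move=> c hc i; pose ci (w : W) := cast_ord (esym sz) (enum_rank w).
have psE w : ps`_(ci w) = mu w.
  have -> : mu w = [seq mu w | w <- enum W]`_(enum_rank w).
    by rewrite (nth_map w) ?nth_enum_rank // -cardE.
  by [].
have bij : bijective ci.
  exists (fun i => enum_val (cast_ord sz i)) => [w|l]; rewrite /ci ?cast_ordKV ?enum_rankK //.
  by rewrite enum_valK cast_ordK.
have [g gK cgK] := bij.
rewrite -[i]cgK; apply: (ind (fun w => c (ci w))).
rewrite (reindex ci) /= in hc; last exact: onW_bij.
by under eq_bigr => w _ do rewrite -psE.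
Qed.
End HilbertCoefficients.

(** * The monomial basis *)

(** No exponent exceeds the degree, so values in ['I_j.+1] lose no monomial and make the set
    finite. *)
Definition fy_set n (Ind : {set {set 'I_n}}) (e j : nat) : {set {ffun {set 'I_n} -> 'I_j.+1}} :=
  [set w : {ffun {set 'I_n} -> 'I_j.+1} |
    fy_normal Ind e (fun K => w K : nat) && (deg (fun K => w K : nat) == j)].

Section Presentation.
Variables (n : nat) (Ind : {set {set 'I_n}}) (e : nat).
Hypotheses (HM : is_matroid Ind) (HL : loopless Ind) (e1 : (e <= 1)%N).
Hypothesis T0 : [set: 'I_n] != set0.
Variables (N : nat) (gs : seq {mpoly rat[N]}) (X : {set 'I_n} -> {mpoly rat[N]}).
Local Notation flat := (is_flat Ind).
Local Notation nzflat := (nonempty_flat Ind).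
Local Notation k := (matroid_rank Ind).

Hypothesis gs0 : forall g, g \in gs -> g@_0%MM = 0.
Hypothesis X_homog : forall F, X F \is 1.-homog.
Hypothesis X_incomp : forall F G, nzflat F -> nzflat G -> ~~ (F \subset G) -> ~~ (G \subset F) ->
  in_ideal gs (X F * X G).
Hypothesis X_atom : forall (a : 'I_n) F, nzflat F -> a \notin F ->
  in_ideal gs (upsum Ind X [set a] * X F).
Hypothesis X_atom_pow : forall a : 'I_n, in_ideal gs (upsum Ind X [set a] ^+ (2 - e)).
Hypothesis X_span : forall i, exists2 q, zspan (fun p => exists2 F, nzflat F & p = X F) q &
  in_ideal gs ('X_i - q).
Hypothesis X_top : forall c : rat, in_ideal gs (c *: X setT ^+ (k - e)) -> c = 0.

Lemma mon_homog (m : {set 'I_n} -> nat) : xmon X m \is (deg m).-homog.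
Proof.
rewrite /xmon /deg; elim: (index_enum _) => [|F s IH]; first by rewrite !big_nil dhomog1.
rewrite !big_cons; apply: dhomogM => //.
by rewrite -[X in X.-homog]mul1n; apply: dhomogMn.
Qed.

(** Rational scalars act on the quotient only through the images [f c%:MP] of constants; this is why
    [mon_indep] takes its coefficients in the ring. *)
Lemma hilb_coeff_fy j : hilb_coeff gs j = #|fy_set Ind e j|.
Proof.
have [A [f fP]] := ideal_quotient_ex gs0.
pose x F := f (X F).
have xup G : upsum Ind x G = f (upsum Ind X G) by rewrite /upsum rmorph_sum.
have x1 F G : nzflat F -> nzflat G -> ~~ (F \subset G) -> ~~ (G \subset F) -> x F * x G = 0.
  by move=> *; rewrite -rmorphM; apply/fP/X_incomp.
have x2 (a : 'I_n) F : nzflat F -> a \notin F -> upsum Ind x [set a] * x F = 0.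
  by move=> *; rewrite xup -rmorphM; apply/fP/X_atom.
have x3 (a : 'I_n) : upsum Ind x [set a] ^+ (2 - e) = 0.
  by rewrite xup -rmorphXn; apply/fP/X_atom_pow.
have fmon m : f (xmon X m) = xmon x m.
  by rewrite rmorph_prod; apply: eq_bigr => F _; rewrite rmorphXn.
pose W := {w | w \in fy_set Ind e j}; pose nw (w : W) K : nat := val w K.
have wN (w : W) : fy_normal Ind e (nw w) by have := valP w; rewrite inE => /andP[].
have wj (w : W) : deg (nw w) = j by have := valP w; rewrite inE => /andP[_ /eqP].
have -> : #|fy_set Ind e j| = #|{: W}| by rewrite card_sig; apply: eq_card.
pose mu w := xmon X (nw w).
have fZ c p : f (c *: p) = f c%:MP * f p by rewrite -mul_mpolyC rmorphM.
apply/eqP; rewrite eqn_leq; apply/andP; split.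
  pose C a := exists c : W -> rat, a = f (\sum_w c w *: mu w).
  have CD a b : C a -> C b -> C (a + b).
    move=> [c ->] [d ->]; exists (fun w => c w + d w); rewrite -rmorphD -big_split; congr (f _).
    by apply: eq_bigr => w _; rewrite scalerDl.
  have CZ d a : C a -> C (f d%:MP * a).
    move=> [c ->]; exists (fun w => d * c w); rewrite -fZ scaler_sumr; congr (f _).
    by apply: eq_bigr => w _; rewrite scalerA.
  have C0 : C 0 by exists (fun=> 0); rewrite big1 ?rmorph0 // => w _; rewrite scale0r.
  have Cz a : zspan (fun a => exists m', [/\ deg m' = j, fy_normal Ind e m' & a = xmon x m']) a -> C a.
    have Cm m' : deg m' = j -> fy_normal Ind e m' -> C (xmon x m').
      move=> m'j m'N; pose w0 : {ffun {set 'I_n} -> 'I_j.+1} := [ffun K => inord (m' K)].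
      have w0E K : w0 K = m' K :> nat.
        by rewrite ffunE inordK // ltnS -m'j /deg (bigD1 K) //= leq_addr.
      have w0P : w0 \in fy_set Ind e j.
        rewrite inE (deg_ext w0E) m'j eqxx andbT.
        have -> // : fy_normal Ind e (fun K => w0 K : nat) = fy_normal Ind e m'.
        by rewrite /fy_normal; apply: eq_forallb => G; rewrite w0E; congr (_ ==> [&& _, _ & _]);
           apply: eq_forallb => D; rewrite w0E.
      exists (fun w => (w == exist _ w0 w0P)%:R).
      rewrite (bigD1 (exist _ w0 w0P)) //= eqxx scale1r big1 ?addr0 => [|w /negPf->].
        by rewrite /mu fmon; apply: mon_ext => K; rewrite /nw /= w0E.
      by rewrite scale0r.
    elim=> [|b c _ Cb [m' [h1 h2 ->]]|b c _ Cb [m' [h1 h2 ->]]] //.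
      by apply: CD => //; apply: Cm.
    rewrite -mulN1r; apply: CD => //; have -> : -1 = f (-1)%:MP.
      by rewrite mpolyCN rmorphN rmorph1.
    by apply: CZ; apply: Cm.
  have Xi i : zspan (monset x nzflat 1 0) (f 'X_i).
    have [q qs /fP] := X_span i; rewrite rmorphB => /eqP; rewrite subr_eq0 => /eqP ->.
    apply: (@zspan_bind _ _ f _ _ _ _ qs) => p [F nF ->]; apply: zspan_gen.
    by have := @monset_dlt _ _ x nzflat F 1 0 nF isT; rewrite expr1.
  have Xm m : zspan (monset x nzflat (mdeg m) 0) (f 'X_[m]).
    rewrite mpolyXE_id rmorph_prod mdegE /=.
    elim: (index_enum _) => [|i s IH].
      rewrite !big_nil; apply: zspan_gen; exists (fun=> 0%N).
      by split=> //; rewrite /deg /xmon ?big1.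
    rewrite !big_cons rmorphXn.
    have := zspan_mul (fun a b => @monset_mul _ _ x nzflat _ _ _ _ a b) (zspan_monset_exp (m i) (Xi i)) IH.
    by rewrite muln1 muln0.
  apply: (@hilb_coeff_le _ _ _ _ mu) => p /dhomogP pj.
  suff [c cE] : C (f p) by exists c; apply/fP; rewrite rmorphB cE subrr.
  rewrite [p]mpolyE rmorph_sum /= big_seq; apply: big_ind => // m mp.
  rewrite fZ; apply: CZ; apply: Cz; have := Xm m; rewrite [mdeg m]pj //.
  apply: (@zspan_bind _ _ idfun) => b [m' [m'f m'j _ ->]].
  by have := mon_span HM HL e1 x1 x2 x3 m'f; rewrite m'j.
apply: (@hilb_coeff_ge _ _ _ _ mu) => [w|c].
  by have := mon_homog (nw w); rewrite wj.
move/fP; rewrite rmorph_sum => /= sum0.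
have top d : f d%:MP * x setT ^+ (k - e) = 0 -> d = 0.
  by rewrite -rmorphXn -fZ => /fP/X_top.
suff h w : f (c w)%:MP = 0 by move=> w; apply: top; rewrite h mul0r.
apply: (mon_indep HM HL e1 x1 x2 x3 T0 (w := nw) (c := fun w => f (c w)%:MP) (j := j)) => //.
- move=> i i' E; apply/val_inj/ffunP => K; apply/val_inj; exact: E.
- by move=> i /top ->; rewrite mpolyC0 rmorph0.
by rewrite -[RHS]sum0; apply: eq_bigr => i _; rewrite fZ /mu fmon.
Qed.
End Presentation.

Lemma sum_nth_enum (T : finType) (V : nmodType) (B : {set {set T}}) (Q : pred {set T}) (f : {set T} -> V) :
  \sum_(i < size (enum B) | Q (nth set0 (enum B) i)) f (nth set0 (enum B) i) = \sum_(K in B | Q K) f K.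
Proof. by rewrite -big_enum_cond /= (big_nth set0) big_mkord. Qed.

Section Instances.
Variables (n : nat) (Ind : {set {set 'I_n}}).
Hypotheses (HM : is_matroid Ind) (HL : loopless Ind).
Local Notation flat := (is_flat Ind).
Local Notation nzflat := (nonempty_flat Ind).
Local Notation k := (matroid_rank Ind).
Local Notation H := {mpoly rat[#|{set 'I_n}|]}.
Implicit Types (F G K : {set 'I_n}).

(** Evaluation at [v] carries the ideal into [ann], and [t] to $h_E$ modulo [ann]. Since $h_E^{k-e}$
    has degree 1, the value of [degree] on the image is [c]. *)
Lemma top_nonzero e N (gs : seq {mpoly rat[N]}) (v : 'I_N -> H) (t : {mpoly rat[N]}) (c : rat) :
  (e <= 1)%N -> (e <= k)%N -> (forall g, g \in gs -> ann Ind e (mmap (@mpolyC _ rat) v g)) ->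
  ann Ind e (mmap (@mpolyC _ rat) v t - hv setT) -> in_ideal gs (c *: t ^+ (k - e)) -> c = 0.
Proof.
move=> e1 ek hgs ht /in_idealP[cs E]; set th := mmap _ _ in hgs ht.
have thM : {morph th : p q / p * q} by move=> p q; apply: rmorphM.
have thX p i : th (p ^+ i) = th p ^+ i by apply: rmorphXn.
have a1 : ann Ind e (th (c *: t ^+ (k - e))).
  rewrite E; have -> : th (\sum_(i < size gs) cs i * gs`_i) = \sum_(i < size gs) th (cs i * gs`_i).
    by apply: raddf_sum.
  apply: ann_sum => i _; rewrite thM; apply: annMl; apply: hgs.
  exact: mem_nth.
have a2 : ann Ind e (th t ^+ (k - e) - hv setT ^+ (k - e)) by rewrite subrXX; apply: annMr.
have : degree Ind e (c *: hv setT ^+ (k - e)) = 0.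
  have -> : c *: hv setT ^+ (k - e) =
      th (c *: t ^+ (k - e)) * 1 + (- c)%:MP * (th t ^+ (k - e) - hv setT ^+ (k - e)) * 1.
    have -> : th (c *: t ^+ (k - e)) = c%:MP * th t ^+ (k - e) by rewrite -thX; apply: mmapZ.
    by rewrite !mulr1 mpolyCN mulNr mulrBr opprB addrC subrK mul_mpolyC.
  by rewrite degreeD a1 (annMl _ a2) addr0.
by rewrite degreeZ degree_top // => h; exact: etrans (esym (mulr1 c)) h.
Qed.

Lemma matroid_rank_gt0 : [set: 'I_n] != set0 -> (0 < k)%N.
Proof. by move=> T0; rewrite /matroid_rank mrank_gt0. Qed.

Lemma flats_ex : exists xh : {set 'I_n} -> H,
  forall F, flat F -> \sum_(K | flat K && (F \subset K)) xh K = hv F.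
Proof. exact: (upper_inversion flat (@hv n)). Qed.


Lemma sum_fibers (V : nmodType) (I : finType) (P : I -> {set 'I_n}) (v : I -> V) (Q : pred {set 'I_n}) :
  \sum_(K | Q K) \sum_(i | P i == K) v i = \sum_(i | Q (P i)) v i.
Proof.
rewrite (exchange_big_dep xpredT) //= [RHS]big_mkcond; apply: eq_bigr => i _; case: ifP => QP.
  by rewrite (big_pred1 (P i)) // => K; rewrite /= andbC eq_sym; case: eqP => // ->.
by rewrite big_pred0 // => K; apply/andP => -[QK /eqP E]; rewrite E QK in QP.
Qed.

Lemma upsumT (V : comNzRingType) (x : {set 'I_n} -> V) (a : 'I_n) :
  upsum Ind x [set a] = x setT + \sum_(K | (flat K && (a \in K)) && (K != setT)) x K.
Proof.
rewrite /upsum (bigD1 setT) /=; last by rewrite flatT subsetT.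
by congr (_ + _); apply: eq_bigl => K; rewrite sub1set.
Qed.

Lemma xh_setT (xh : {set 'I_n} -> H) :
  (forall F, flat F -> \sum_(K | flat K && (F \subset K)) xh K = hv F) -> xh setT = hv setT.
Proof.
move=> xhE; rewrite -xhE ?flatT // (big_pred1 setT) // => K.
by rewrite subTset /=; case: eqP => [->|]; rewrite ?andbF // flatT.
Qed.

Lemma xh_above (xh : {set 'I_n} -> H) (a : 'I_n) :
  (forall F, flat F -> \sum_(K | flat K && (F \subset K)) xh K = hv F) ->
  \sum_(K | (flat K && (a \in K)) && (K != setT)) xh K = hv (mclosure Ind [set a]) - hv setT.
Proof.
move=> xhE; rewrite -(xhE (mclosure Ind [set a])) ?flat_cl // -(xh_setT xhE).
rewrite [X in _ = X - _](bigD1 setT) /=; last by rewrite flatT subsetT.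
rewrite addrAC subrr add0r; apply: eq_bigl => K; case fK: (flat K) => //=.
by rewrite sub_clE // sub1set.
Qed.

(** * The reduced Chow ring *)

Section Reduced.
Variable a0 : 'I_n.
Local Notation P i := (nth set0 (pflats Ind) i).
Local Notation R := {mpoly rat[size (pflats Ind)]}.

(** The value at [setT] makes $h_{a_0}$ vanish identically; the linear relations extend this to
    every point. *)
Definition redX F : R :=
  if F == setT then - \sum_(i < size (pflats Ind) | a0 \in P i) 'X_i
  else \sum_(i < size (pflats Ind) | P i == F) 'X_i.

Lemma pflatsP (i : 'I_(size (pflats Ind))) : nzflat (P i) && (P i != setT).
Proof.
have := mem_nth set0 (ltn_ord i); rewrite /pflats mem_enum !inE.
by rewrite /nonempty_flat andbA.
Qed.

Lemma redX_nth (i : 'I_(size (pflats Ind))) : redX (P i) = 'X_i.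
Proof.
have /andP[_ /negPf PT] := pflatsP i; rewrite /redX PT (big_pred1 i) // => j.
by rewrite /= nth_uniq ?enum_uniq ?ltn_ord.
Qed.

Lemma redX_above (a : 'I_n) :
  \sum_(K | (flat K && (a \in K)) && (K != setT)) redX K = \sum_(i < size (pflats Ind) | a \in P i) 'X_i.
Proof.
rewrite (eq_bigr (fun K => \sum_(i < size (pflats Ind) | P i == K) 'X_i)); last first.
  by move=> K /andP[_ /negPf KT]; rewrite /redX KT.
rewrite sum_fibers; apply: eq_bigl => i; have /andP[/andP[-> _] ->] := pflatsP i.
by rewrite andbT.
Qed.

Lemma redX_linear a b : in_ideal (redchow_gens Ind)
  (\sum_(i < size (pflats Ind) | a \in P i) 'X_i - \sum_(i < size (pflats Ind) | b \in P i) 'X_i).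
Proof.
apply: in_ideal_gen; rewrite mem_cat; apply/orP; right.
by apply/allpairsP; exists (a, b); rewrite !mem_enum.
Qed.

Lemma redX_atom a : in_ideal (redchow_gens Ind) (upsum Ind redX [set a]).
Proof. by rewrite upsumT redX_above /redX eqxx addrC; apply: redX_linear. Qed.

Lemma redchow_gensP g : g \in redchow_gens Ind ->
  (exists i j : 'I_(size (pflats Ind)), incomparable (P i) (P j) /\ g = 'X_i * 'X_j) \/
  (exists a b : 'I_n, g = \sum_(i < size (pflats Ind) | a \in P i) 'X_i - \sum_(i < size (pflats Ind) | b \in P i) 'X_i).
Proof.
rewrite mem_cat => /orP[/mapP[[i j]]|/allpairsP[[a b] [_ _ ->]]]; last by right; exists a, b.
by rewrite mem_enum inE /= => ij ->; left; exists i, j.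
Qed.

Lemma redchow_hilb_fy j : redchow_hilb Ind j = #|fy_set Ind 1 j|.
Proof.
have T0 : [set: 'I_n] != set0 by apply/set0Pn; exists a0.
apply: (@hilb_coeff_fy _ _ _ HM HL _ T0 _ _ redX) => //.
- move=> g /redchow_gensP[[i [l [_ ->]]]|[a [b ->]]].
    by rewrite -mpolyXD mcoeffX -mdeg_eq0 mdegD !mdeg1.
  have h c : (\sum_(i < size (pflats Ind) | c \in P i) 'X_i : R)@_0%MM = 0.
    by rewrite raddf_sum big1 // => i _ /=; rewrite mcoeffX -mdeg_eq0 mdeg1.
  by rewrite mcoeffB !h subrr.
- have X1 (Q : pred 'I_(size (pflats Ind))) : \sum_(i < size (pflats Ind) | Q i) 'X_i \is 1.-homog.
    by apply: rpred_sum => i _; rewrite dhomogX /= mdeg1.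
  by move=> F; rewrite /redX; case: ifP => _; rewrite ?rpredN; apply: X1.
- move=> F G nF nG FG GF.
  have FT : F != setT by apply: contraNneq GF => ->; apply: subsetT.
  have GT : G != setT by apply: contraNneq FG => ->; apply: subsetT.
  rewrite /redX (negPf FT) (negPf GT) big_distrlr /=.
  apply: in_ideal_sum => i /eqP iF; apply: in_ideal_sum => l /eqP lG.
  apply: in_ideal_gen; rewrite mem_cat; apply/orP; left; apply/mapP; exists (i, l) => //.
  by rewrite mem_enum inE /= /incomparable iF lG FG.
- by move=> a F _ _; rewrite mulrC -[_ * _]addr0; apply: in_ideal_comb; [apply: redX_atom|apply: in_ideal0].
- by move=> a; rewrite expr1; apply: redX_atom.
- move=> i; exists 'X_i; last by rewrite subrr; apply: in_ideal0.
  by apply: zspan_gen; exists (P i); [have /andP[] := pflatsP i|rewrite redX_nth].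
have [xh xhE] := flats_ex; move=> c.
pose v (i : 'I_(size (pflats Ind))) := xh (P i).
have th_sum a : mmap (@mpolyC _ rat) v (\sum_(i < size (pflats Ind) | a \in P i) 'X_i) = hv (mclosure Ind [set a]) - hv setT.
  rewrite raddf_sum /= -(@xh_above xh a xhE).
  rewrite (eq_bigr (fun i : 'I_(size (pflats Ind)) => xh (P i))) => [|i _]; last by rewrite mmapX mmap1U.
  rewrite [LHS](@sum_nth_enum _ _ _ (fun K => a \in K) xh); apply: eq_bigl => K.
  by rewrite !inE; case: (eqVneq K set0) => [->|_]; rewrite ?inE ?andbF //= -!andbA [_ && (K != _)]andbC.
apply: (@top_nonzero 1 _ _ v) => //.
- exact: matroid_rank_gt0.
- move=> g /redchow_gensP[[i [l [il ->]]]|[a [b ->]]].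
    rewrite rmorphM /= !mmapX !mmap1U; have /andP[/andP[fi _] _] := pflatsP i.
    have /andP[/andP[fl _] _] := pflatsP l; have /andP[h1 h2] := il.
    exact: (ann_incomp HM _ xhE).
  rewrite mmapB !th_sum opprB addrA subrK; apply: annB; exact: ann_atom.
rewrite /redX eqxx mmapN th_sum opprB addrAC subrr add0r; apply: annN; exact: ann_atom.
Qed.
End Reduced.

(** * The augmented Chow ring *)

Section Augmented.
Variable a0 : 'I_n.
Local Notation M := (size (nflats Ind)).
Local Notation P i := (nth set0 (nflats Ind) i).
Local Notation R := {mpoly rat[M + n]}.
Local Notation vx i := ('X_(lshift n i) : R).
Local Notation vy a := ('X_(rshift M a) : R).

(** The value at [setT] makes all $x_F$, the one of the empty flat included, sum to zero, so that
    $h_a$ becomes $-y_a$ modulo the ideal. *)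
Definition augX F : R :=
  if F == setT then - \sum_(i < M) vx i else \sum_(i < M | P i == F) vx i.

Lemma nflatsP (i : 'I_M) : flat (P i) && (P i != setT).
Proof. by have := mem_nth set0 (ltn_ord i); rewrite /nflats mem_enum !inE. Qed.

Lemma augX_nth (i : 'I_M) : augX (P i) = vx i.
Proof.
have /andP[_ /negPf PT] := nflatsP i; rewrite /augX PT (big_pred1 i) // => j.
by rewrite /= nth_uniq ?enum_uniq ?ltn_ord.
Qed.

Lemma sum_augX (Q : pred {set 'I_n}) :
  \sum_(K | (flat K && Q K) && (K != setT)) augX K = \sum_(i < M | Q (P i)) vx i.
Proof.
rewrite (eq_bigr (fun K => \sum_(i < M | P i == K) vx i)); last first.
  by move=> K /andP[_ /negPf KT]; rewrite /augX KT.
rewrite sum_fibers; apply: eq_bigl => i; have /andP[-> ->] := nflatsP i.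
by rewrite andbT.
Qed.

Lemma augX_upsum a : upsum Ind augX [set a] = - \sum_(i < M | a \notin P i) vx i.
Proof.
rewrite upsumT sum_augX {1}/augX eqxx (bigID (fun i : 'I_M => a \in P i)) /=.
by rewrite opprD addrAC addNr add0r.
Qed.

Lemma aug_gen_linear a : in_ideal (chow_gens Ind) (vy a - \sum_(i < M | a \notin P i) vx i).
Proof.
by apply: in_ideal_gen; rewrite mem_cat; apply/orP; left; apply/mapP; exists a; rewrite ?mem_enum.
Qed.

Lemma aug_gen_incomp (i l : 'I_M) : incomparable (P i) (P l) -> in_ideal (chow_gens Ind) (vx i * vx l).
Proof.
move=> il; apply: in_ideal_gen; rewrite !mem_cat; apply/orP; right; apply/orP; left.
by apply/mapP; exists (i, l); rewrite ?mem_enum ?inE.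
Qed.

Lemma aug_gen_yx a (i : 'I_M) : a \notin P i -> in_ideal (chow_gens Ind) (vy a * vx i).
Proof.
move=> ai; apply: in_ideal_gen; rewrite !mem_cat; apply/orP; right; apply/orP; right.
by apply/mapP; exists (a, i); rewrite ?mem_enum ?inE.
Qed.

Lemma chow_gensP g : g \in chow_gens Ind ->
  [\/ exists a, g = vy a - \sum_(i < M | a \notin P i) vx i,
      exists i l : 'I_M, incomparable (P i) (P l) /\ g = vx i * vx l |
      exists a (i : 'I_M), a \notin P i /\ g = vy a * vx i].
Proof.
rewrite !mem_cat => /orP[/mapP[a _ ->]|/orP[/mapP[[i l]]|/mapP[[a i]]]].
- by constructor 1; exists a.
- by rewrite mem_enum inE /= => il ->; constructor 2; exists i, l.
- by rewrite mem_enum inE /= => ai ->; constructor 3; exists a, i.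
Qed.

Lemma in_ideal_upsum_mul a p : in_ideal (chow_gens Ind) (vy a * p) ->
  in_ideal (chow_gens Ind) (upsum Ind augX [set a] * p).
Proof.
move=> yp; rewrite augX_upsum.
have -> : - (\sum_(i < M | a \notin P i) vx i) * p =
    p * (vy a - \sum_(i < M | a \notin P i) vx i) + ((-1) * (vy a * p) + 0).
  by rewrite addr0 mulN1r mulrBr addrAC [p * vy a]mulrC subrr add0r mulrC mulrN.
apply: in_ideal_comb; first exact: aug_gen_linear.
by apply: in_ideal_comb; last exact: in_ideal0.
Qed.

Lemma chow_hilb_fy j : chow_hilb Ind j = #|fy_set Ind 0 j|.
Proof.
have T0 : [set: 'I_n] != set0 by apply/set0Pn; exists a0.
have X1 (Q : pred 'I_M) : \sum_(i < M | Q i) vx i \is 1.-homog.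
  by apply: rpred_sum => i _; rewrite dhomogX /= mdeg1.
apply: (@hilb_coeff_fy _ _ _ HM HL _ T0 _ _ augX) => //.
- have c0 (i l : 'I_(M + n)) : ('X_i * 'X_l : R)@_0%MM = 0.
    by rewrite -mpolyXD mcoeffX -mdeg_eq0 mdegD !mdeg1.
  have s0 (i : 'I_(M + n)) : ('X_i : R)@_0%MM = 0 by rewrite mcoeffX -mdeg_eq0 mdeg1.
  move=> g /chow_gensP[[a ->]|[i [l [_ ->]]]|[a [i [_ ->]]]]; rewrite ?c0 //.
  by rewrite mcoeffB s0 raddf_sum big1 ?subrr // => i _; apply: s0.
- by move=> F; rewrite /augX; case: ifP => _; rewrite ?rpredN; apply: X1.
- move=> F G nF nG FG GF.
  have FT : F != setT by apply: contraNneq GF => ->; apply: subsetT.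
  have GT : G != setT by apply: contraNneq FG => ->; apply: subsetT.
  rewrite /augX (negPf FT) (negPf GT) big_distrlr /=.
  apply: in_ideal_sum => i /eqP iF; apply: in_ideal_sum => l /eqP lG.
  by apply: aug_gen_incomp; rewrite /incomparable iF lG FG.
- move=> a F _ aF; apply: in_ideal_upsum_mul.
  have FT : F != setT by apply: contraNneq aF => ->; rewrite inE.
  rewrite /augX (negPf FT) big_distrr /=.
  by apply: in_ideal_sum => i /eqP iF; apply: aug_gen_yx; rewrite iF.
(* Both factors are $-y_a$ modulo the ideal; the second is expanded into the $x_F$ with $a\notin F$,
   each of which $y_a$ kills. *)
- move=> a; rewrite expr2; apply: in_ideal_upsum_mul; rewrite augX_upsum mulrN -mulN1r -[_ * _]addr0.
  apply: in_ideal_comb; last exact: in_ideal0.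
  by rewrite big_distrr /=; apply: in_ideal_sum => i; apply: aug_gen_yx.
- move=> i; case: (split_ordP i) => [l ->|a ->].
    have [P0|P0] := eqVneq (P l) set0; last first.
      exists (vx l); last by rewrite subrr; apply: in_ideal0.
      apply: zspan_gen; exists (P l); last by rewrite augX_nth.
      by have /andP[fl _] := nflatsP l; rewrite /nonempty_flat fl.
    exists (- \sum_(K | (flat K && (K != set0)) && (K != setT)) augX K - augX setT).
      apply: zspan_add; apply: zspan_opp; last first.
        by apply: zspan_gen; exists setT; rewrite // /nonempty_flat T0 flatT.
      by apply: zspan_sum => K /andP[nK _]; apply: zspan_gen; exists K.
    have xl : \sum_(i < M | P i == set0) vx i = vx l.
      by rewrite -augX_nth /augX P0 eq_sym (negPf T0).
    rewrite sum_augX /augX eqxx opprK [\sum_(i < M) vx i](bigID (fun i : 'I_M => P i == set0)) /= xl.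
    by rewrite addrCA addNr addr0 subrr; apply: in_ideal0.
  exists (- upsum Ind augX [set a]); last by rewrite augX_upsum opprK; apply: aug_gen_linear.
  apply: zspan_opp; apply: zspan_sum => K /andP[fK aK]; apply: zspan_gen; exists K => //.
  by rewrite sub1set in aK; apply: nzflat_mem aK.
have [xh xhE] := flats_ex; move=> c.
(* The value of $y_a$ is forced: the flats missing [a] are all flats except those above the closure
   of [a]. *)
pose v (i : 'I_(M + n)) := match split i with
  | inl i => xh (P i) | inr a => hv set0 - hv (mclosure Ind [set a]) end.
have vE i : mmap (@mpolyC _ rat) v (vx i) = xh (P i).
  by rewrite mmapX mmap1U /v (unsplitK (inl _ i)).
have vE' a : mmap (@mpolyC _ rat) v (vy a) = hv set0 - hv (mclosure Ind [set a]).
  by rewrite mmapX mmap1U /v (unsplitK (inr _ a)).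
have th_sum (Q : pred {set 'I_n}) : mmap (@mpolyC _ rat) v (\sum_(i < M | Q (P i)) vx i) =
    \sum_(K | flat K && (K != setT) && Q K) xh K.
  rewrite raddf_sum /= (eq_bigr (fun i : 'I_M => xh (P i))) => [|i _]; last exact: vE.
  rewrite [LHS](@sum_nth_enum _ _ _ Q xh); apply: eq_bigl => K; by rewrite !inE.
have xh0 : \sum_(K | flat K && (K != setT)) xh K = hv set0 - hv setT.
  rewrite -(xhE set0) ?flat0 // -(xh_setT xhE) [X in X - _](bigD1 setT) /=; last by rewrite flatT sub0set.
  rewrite addrAC subrr add0r; apply: eq_bigl => K; by rewrite sub0set andbT.
have th_lin a : mmap (@mpolyC _ rat) v (\sum_(i < M | a \notin P i) vx i) = hv set0 - hv (mclosure Ind [set a]).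
  rewrite (th_sum (fun K => a \notin K)); have := xh0.
  rewrite (bigID (fun K : {set 'I_n} => a \in K)) /=.
  rewrite (eq_bigl (fun K => (flat K && (a \in K)) && (K != setT))) => [|K]; last by rewrite andbAC.
  rewrite (@xh_above xh a xhE) => E.
  have -> : hv set0 - hv (mclosure Ind [set a]) = (hv set0 - hv setT) - (hv (mclosure Ind [set a]) - hv setT).
    by rewrite opprB addrA subrK.
  by rewrite -E addrC addrK.
apply: (@top_nonzero 0 _ _ v) => //.
- move=> g /chow_gensP[[a ->]|[i [l [il ->]]]|[a [i [ai ->]]]].
  + by rewrite mmapB vE' th_lin subrr; apply: ann0.
  + rewrite rmorphM /= !vE; have /andP[fi _] := nflatsP i; have /andP[fl _] := nflatsP l.
    by have /andP[h1 h2] := il; apply: (ann_incomp HM _ xhE).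
  rewrite rmorphM /= vE vE' mulrBl; have /andP[fi _] := nflatsP i.
  apply: annB; first by apply: annMr; apply: ann_set0.
  exact: (ann_atom_x HM _ xhE).
rewrite /augX eqxx mmapN (th_sum xpredT).
rewrite (eq_bigl (fun K => flat K && (K != setT))) => [|K]; last by rewrite andbT.
by rewrite xh0 opprB addrAC subrr add0r; apply: annN; apply: ann_set0.
Qed.

End Augmented.

End Instances.

(** * Comparison with the uniform matroid *)

Local Open Scope nat_scope.

Section Uniform.
Variables (k n : nat).
Hypotheses (k0 : 0 < k) (kn : k <= n).
Local Notation U := (uniform k n).

Lemma uniform_matroid : is_matroid U.
Proof.
split=> [|A B|A B]; rewrite ?inE ?cards0 //.
  by move=> Bk AB; apply: leq_trans Bk; apply: subset_leq_card.
move=> _ Bk lt; have /subsetPn[x xB xA] : ~~ (B \subset A).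
  by apply: contraL lt => /subset_leq_card; rewrite -leqNgt.
by exists x; rewrite ?inE ?xA // cardsU1 xA add1n (leq_trans lt).
Qed.

Lemma uniform_loopless : loopless U.
Proof. by move=> x; rewrite inE cards1. Qed.

Lemma uniform_rank : matroid_rank U = k.
Proof.
have [J [JU _ _ rJ]] := mrank_basis uniform_matroid (indep0 uniform_matroid) (sub0set setT).
have Jk : #|J| <= k by rewrite inE in JU.
apply/eqP; rewrite /matroid_rank -rJ eqn_leq Jk leqNgt; apply/negP => lt.
have /subsetPn[x _ xJ] : ~~ ([set: 'I_n] \subset J).
  by apply: contraL lt => /subset_leq_card; rewrite cardsT card_ord -leqNgt; apply: leq_trans.
have : #|x |: J| <= mrank U setT by rewrite mrank_ge ?subsetT ?inE ?cardsU1 ?xJ //; exact: uniform_matroid.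
by rewrite -rJ cardsU1 xJ add1n ltnn.
Qed.

Lemma uniform_flat (S : {set 'I_n}) : #|S| < k -> is_flat U S.
Proof.
move=> Sk; apply/forallP => x; apply/implyP => xS.
by rewrite !(mrank_indep uniform_matroid) ?inE ?cardsU1 ?xS // ltnW.
Qed.
End Uniform.

(** * Transporting normal monomials to the uniform matroid *)

Section Injection.
Variables (n : nat) (Ind : {set {set 'I_n}}) (e : nat).
Hypotheses (HM : is_matroid Ind) (HL : loopless Ind).
Hypothesis T0 : [set: 'I_n] != set0.
Local Notation r := (mrank Ind).
Local Notation k := (matroid_rank Ind).
Local Notation U := (uniform k n).
Implicit Types (F G S : {set 'I_n}) (m : {set 'I_n} -> nat).

Lemma rank_le : k <= n.
Proof. by rewrite -[leqRHS]card_ord -cardsT mrank_le_card. Qed.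

Definition adapted_basis m : {set 'I_n} :=
  odflt set0 [pick B in Ind | [forall F, (m F != 0) ==> (#|B :&: F| == r F)]].

(** For [k < n] a [k]-subset is not a flat of [U], so [setT] has to go to [setT]; a proper flat of
    the support goes to a set of size below [k], which is a flat. *)
Definition flat_to_uniform m F := if F == setT then setT else adapted_basis m :&: F.

(** As a sum over fibres it preserves the degree at once; for normal [m] each fibre meets the
    support in at most one flat. *)
Definition transfer m S := \sum_(F | flat_to_uniform m F == S) m F.

Section Monomial.
Variable m : {set 'I_n} -> nat.
Hypothesis mN : fy_normal Ind e m.
Local Notation beta := (flat_to_uniform m).

Lemma normal_nzflat F : m F != 0 -> nonempty_flat Ind F.
Proof. by case/(fy_normalP e HM): mN => h _ _; apply: h. Qed.

Lemma normal_chain : chain (supp m).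
Proof. by case/(fy_normalP e HM): mN. Qed.

Lemma adapted_basisP : adapted_basis m \in Ind /\
  forall F, m F != 0 -> #|adapted_basis m :&: F| = r F.
Proof.
rewrite /adapted_basis; case: pickP => [B /andP[BI /forallP hB]|no] /=.
  by split=> // F mF; have /implyP/(_ mF)/eqP := hB F.
have [B BI hB] := nested_bases HM normal_chain.
have := no B; rewrite BI /=; move=> /negP[]; apply/forallP => F; apply/implyP => mF.
by apply/eqP/hB; rewrite inE.
Qed.

Lemma beta_sub F : beta F \subset F.
Proof. by rewrite /flat_to_uniform; case: eqP => [->|_]; rewrite ?subxx ?subsetIr. Qed.

Lemma betaS F G : F \subset G -> beta F \subset beta G.
Proof.
rewrite /flat_to_uniform; case: (eqVneq G setT) => [-> _|GT FG]; first exact: subsetT.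
by rewrite ifF ?setIS //; apply: contraNF GT => /eqP FT; rewrite -subTset -FT.
Qed.

Lemma beta_rank F : m F != 0 -> r (beta F) = r F.
Proof.
move=> mF; rewrite /flat_to_uniform; case: eqP => [->//|_].
have [BI hB] := adapted_basisP; rewrite mrank_indep ?hB //.
by apply: indep_sub BI _; rewrite // subsetIl.
Qed.

Lemma cl_beta F : m F != 0 -> mclosure Ind (beta F) = F.
Proof.
move=> mF; have /andP[fF _] := normal_nzflat mF.
apply/eqP; rewrite eqEproper cl_min ?beta_sub //; apply/negP => /(mrank_proper HM (flat_cl HM _)).
by rewrite mrank_cl // beta_rank // ltnn.
Qed.

Lemma beta_flat F : m F != 0 -> is_flat U (beta F) /\ mrank U (beta F) = r F.
Proof.
move=> mF; have UM := uniform_matroid k n; have /andP[fF _] := normal_nzflat mF.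
rewrite /flat_to_uniform; have [->|FT] := eqVneq F setT.
  by split; [apply: flatT|apply: uniform_rank; apply: rank_le].
have [BI hB] := adapted_basisP; have lt := mrank_flat_lt HM fF FT.
by split; [apply: uniform_flat; rewrite hB|rewrite (mrank_indep UM) ?inE ?hB // ltnW].
Qed.

Lemma beta_inj F G : m F != 0 -> m G != 0 -> beta F = beta G -> F = G.
Proof. by move=> mF mG E; rewrite -(cl_beta mF) E cl_beta. Qed.

Lemma transfer_beta F : m F != 0 -> transfer m (beta F) = m F.
Proof.
move=> mF; rewrite /transfer (bigD1 F) //= big1 ?addn0 // => G /andP[/eqP E GF].
by apply/eqP; apply: contraNT GF => mG; rewrite (beta_inj mG mF E).
Qed.

Lemma transfer_supp S : transfer m S != 0 -> exists2 F, m F != 0 & S = beta F.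
Proof.
move=> tS; have [/existsP[F /andP[mF /eqP ->]]|/existsPn h] := boolP [exists F, (m F != 0) && (S == beta F)].
  by exists F.
move: tS; rewrite /transfer big1 ?eqxx // => F /eqP E.
by apply/eqP; have := h F; rewrite -E eqxx andbT negbK.
Qed.

Lemma transfer_normal : fy_normal U e (transfer m).
Proof.
have rhoE F : m F != 0 -> shifted_rank U e (beta F) = shifted_rank Ind e F.
  by move=> mF; rewrite /shifted_rank; have [_ ->] := beta_flat mF.
apply/forallP => S; apply/implyP => /transfer_supp[G mG ->].
have /forallP/(_ G) := mN; rewrite mG /= => /and3P[/andP[fG G0] mr /forallP hC].
have [fbG rG] := beta_flat mG; rewrite transfer_beta // rhoE // mr /nonempty_flat fbG /=; apply/andP; split.
  by rewrite -(mrank_gt0 (uniform_matroid k n)) ?rG ?mrank_gt0 //; exact: uniform_loopless (matroid_rank_gt0 HM HL T0).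
apply/forallP => S'; apply/implyP => /transfer_supp[C mC ->].
have := hC C; rewrite mC /= => /andP[CG lt]; apply/andP; split.
  by case/orP: CG => h; rewrite (betaS h) ?orbT.
(* Strict inclusion of images pulls back: [C] and [G] are comparable, and [G] inside [C] would
   contradict [betaS]. *)
apply/implyP => /properP[_ [a aG aC]]; rewrite rhoE //; apply: (implyP lt).
have GC : ~~ (G \subset C) by apply: contra aC => /betaS/subsetP; apply.
by rewrite properE GC andbT; move: CG; rewrite (negPf GC) orbF.
Qed.

Lemma transfer_deg : deg (transfer m) = deg m.
Proof. by rewrite /deg /transfer (sum_fibers beta m xpredT). Qed.

End Monomial.

(** The bases chosen for [m1] and [m2] may differ, but a flat is the closure in $M$ of its image,
    which does not refer to the basis. *)
Lemma transfer_inj m1 m2 : fy_normal Ind e m1 -> fy_normal Ind e m2 ->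
  transfer m1 =1 transfer m2 -> m1 =1 m2.
Proof.
suff H : forall m1 m2, fy_normal Ind e m1 -> fy_normal Ind e m2 -> transfer m1 =1 transfer m2 ->
    forall F, m1 F != 0 -> m2 F = m1 F.
  move=> N1 N2 E F; have [m10|m1F] := eqVneq (m1 F) 0; last by rewrite (H m1 m2).
  have [m20|m2F] := eqVneq (m2 F) 0; first by rewrite m10 m20.
  by apply: (H m2 m1) => // S; rewrite E.
move=> {}m1 {}m2 N1 N2 E F mF; have tF := transfer_beta N1 mF; rewrite E in tF.
have [|G mG bE] := @transfer_supp m2 (flat_to_uniform m1 F); first by rewrite tF.
have FG : F = G by rewrite -(cl_beta N1 mF) bE cl_beta.
by rewrite -tF bE transfer_beta // FG.
Qed.

Lemma fy_set_le j : #|fy_set Ind e j| <= #|fy_set U e j|.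
Proof.
pose nat_of (w : {ffun {set 'I_n} -> 'I_j.+1}) S : nat := w S.
pose phi w : {ffun {set 'I_n} -> 'I_j.+1} := [ffun S => inord (transfer (nat_of w) S)].
have phiE w : w \in fy_set Ind e j -> nat_of (phi w) =1 transfer (nat_of w).
  rewrite inE => /andP[wN /eqP wj] S; rewrite /nat_of ffunE inordK // ltnS.
  by rewrite -[leqRHS]wj -(transfer_deg (nat_of w)) /deg (bigD1 S) //= leq_addr.
have inj : {in fy_set Ind e j &, injective phi}.
  move=> w1 w2 h1 h2 E; have := h1; have := h2; rewrite !inE => /andP[N2 _] /andP[N1 _].
  apply/ffunP => S; apply/val_inj; apply: (transfer_inj N1 N2) => S'.
  by rewrite -(phiE _ h1) -(phiE _ h2) E.
rewrite -(card_in_imset inj); apply/subset_leq_card/subsetP => _ /imsetP[w wP ->].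
have := wP; rewrite !inE => /andP[wN /eqP wj].
rewrite (deg_ext (phiE _ wP)) (transfer_deg (nat_of w)) [deg _]wj eqxx andbT.
have := transfer_normal wN; congr is_true; apply: eq_forallb => G; rewrite -(phiE _ wP).
by congr (_ ==> [&& _, _ & _]); apply: eq_forallb => C; rewrite -(phiE _ wP).
Qed.

End Injection.

Lemma matroid_ord0 (Ind Ind' : {set {set 'I_0}}) : is_matroid Ind -> is_matroid Ind' -> Ind = Ind'.
Proof.
move=> /indep0 h /indep0 h'; apply/setP => S.
by rewrite (_ : S = set0) ?h ?h' //; apply/setP => -[].
Qed.

Theorem theorem1p13 (n k : nat) (Ind : {set {set 'I_n}}) :
  is_matroid Ind -> loopless Ind -> matroid_rank Ind = k ->
  (forall j : nat, (redchow_hilb Ind j <= redchow_hilb (uniform k n) j)%N) /\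
  (forall j : nat, (chow_hilb Ind j <= chow_hilb (uniform k n) j)%N).
Proof.
move=> HM HL <-; have UM := uniform_matroid (matroid_rank Ind) n.
(* On the empty ground set [setT] is not a nonempty flat and [T0] fails; there both matroids are
   equal. *)
case: n => [|n] in Ind HM HL UM *; first by rewrite (matroid_ord0 UM HM).
have T0 : [set: 'I_n.+1] != set0 by apply/set0Pn; exists ord0.
have UL := uniform_loopless (n := n.+1) (matroid_rank_gt0 HM HL T0).
split=> j.
  by rewrite !(redchow_hilb_fy _ _ ord0) // fy_set_le.
by rewrite !(chow_hilb_fy _ _ ord0) // fy_set_le.
Qed.
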